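(* Let $0<\alpha<1$, let $C_0=\frac{1}{\Gamma(1-\alpha)\Gamma(\alpha)}$, $a(x)=C_0x^{\alpha-1}\mathbf{1}_{x>0}$, $b(x)=-C_0\frac{(x-1)^\alpha}{x}\mathbf{1}_{x>1}$, and $g_j=a*b^{*j}$ for $j\ge0$. Write $d_x=\mathrm{d}/\mathrm{d}x$ and define the differential operators $D_j=d_x\circ(x-j)-(j+1)\alpha$ (i.e. $D_j f = \frac{d}{dx}\bigl((x-j)f(x)\bigr)-(j+1)\alpha f(x)$) and $E_k=D_{k-1}\cdots D_0$. Then for every $k\ge1$, $E_k$ annihilates each of $g_0,\dots,g_{k-1}$ (outside integer points). In particular, $E_k$ annihilates the Darling--Mandelbrot density $g$ of parameter $\alpha$ on the interval $[0,k]$ (outside integer points).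
   Context: Convolution is $(u*v)(x)=\int u(y)v(x-y)\,dy$. For $0<\alpha<1$, the Darling--Mandelbrot distribution of parameter $\alpha$ is the probability distribution on $\mathbb{R}_+$ with characteristic function $\bigl(1-\sum_{n\ge1}\frac{\alpha}{n-\alpha}\frac{(is)^n}{n!}\bigr)^{-1}$; its density is $g$. *)

(* Defs.v *)
From HB Require Import structures.
From mathcomp Require Import all_boot all_order all_algebra.
From mathcomp Require Import complex.
From mathcomp Require Import all_classical all_reals all_analysis.

Set Implicit Arguments.
Unset Strict Implicit.
Unset Printing Implicit Defensive.

Import Order.TTheory GRing.Theory Num.Theory.
Import numFieldNormedType.Exports.

Local Open Scope classical_set_scope.
Local Open Scope ring_scope.
Local Open Scope complex_scope.

Definition gamma_fun (R : realType) (s : R) : R :=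
  \int[@lebesgue_measure R]_(t in `]0, +oo[) (t `^ (s - 1) * expR (- t)).

Definition convolution (R : realType) (u v : R -> R) (x : R) : R :=
  \int[@lebesgue_measure R]_y (u y * v (x - y)).

(* [conv_powS v j] is v^{*(j+1)}. *)
Fixpoint conv_powS (R : realType) (v : R -> R) (j : nat) : R -> R :=
  if j is j'.+1 then convolution v (conv_powS v j') else v.

Definition dm_C0 (R : realType) (alpha : R) : R :=
  1 / (gamma_fun (1 - alpha) * gamma_fun alpha).

Definition dm_a (R : realType) (alpha x : R) : R :=
  if 0 < x then dm_C0 alpha * x `^ (alpha - 1) else 0.

Definition dm_b (R : realType) (alpha x : R) : R :=
  if 1 < x then - dm_C0 alpha * ((x - 1) `^ alpha / x) else 0.

(* g_j = a * b^{*j}; b^{*0} is the unit of convolution (the Dirac mass at 0,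
   which is not a function), so that g_0 = a. *)
Definition dm_g (R : realType) (alpha : R) (j : nat) : R -> R :=
  if j is j'.+1 then convolution (dm_a alpha) (conv_powS (dm_b alpha) j')
  else dm_a alpha.

Definition opD (R : realType) (alpha : R) (j : nat) (f : R -> R) : R -> R :=
  fun x => derive1 (fun y : R => (y - j%:R) * f y) x - j.+1%:R * alpha * f x.

Fixpoint opE (R : realType) (alpha : R) (k : nat) (f : R -> R) : R -> R :=
  if k is k'.+1 then opD alpha k' (opE alpha k' f) else f.

(* [derive1] is total, hence the requirement that every derivative occurring in
   E_k f exists at x. *)
Definition opE_annihilates_at (R : realType) (alpha : R) (k : nat)
    (f : R -> R) (x : R) : Prop :=
  (forall j, (j < k)%N ->
     derivable (fun y : R => (y - j%:R) * opE alpha j f y) x 1) /\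
  opE alpha k f x = 0.

(* E[exp(isX)], written through its real and imaginary parts because the
   integral is only available for real-valued functions. *)
Definition char_fun (R : realType)
    (mu : probability (measurableTypeR R) R) (s : R) : R[i] :=
  (\int[mu]_x cos (s * x)) +i* (\int[mu]_x sin (s * x)).

Definition dm_series (R : realType) (alpha s : R) (N : nat) : R[i] :=
  \sum_(1 <= n < N)
    ((alpha / (n%:R - alpha))%:C * ((0 +i* s) ^+ n / (n`!)%:R)).

(* The cast to numFieldType selects the topology of the complex modulus. *)
Definition dm_char_fun (R : realType) (alpha s : R) : R[i] :=
  (1 - limn (dm_series alpha s : nat -> (R[i] : numFieldType)))^-1.

Definition is_dm_distribution (R : realType) (alpha : R)
    (mu : probability (measurableTypeR R) R) : Prop :=
  mu `[0, +oo[%classic = 1%E /\ forall s : R, char_fun mu s = dm_char_fun alpha s.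

Definition is_density (R : realType)
    (mu : probability (measurableTypeR R) R) (g : R -> R) : Prop :=
  [/\ measurable_fun setT g, forall x, 0 <= g x &
      forall A : set (measurableTypeR R), measurable A ->
        mu A = (\int[@lebesgue_measure R]_(x in A) (g x)%:E)%E].

(* Main.v *)
(* Idea.  Write H for the Heaviside function, beta = - b >= 0, tau_i for the
   translation by i, and G(i, m) = a * (tau_1 a)^{*i} * beta^{*m}, so that
   g_n = (-1)^n G(0, n).  Since x a = alpha (H * a) and
   x beta = alpha (H * tau_1 a), and since multiplication by x is a derivation
   for the convolution,
     (x - i) G(i, m) = H * ((i + 1) alpha G(i, m) + m alpha G(i + 1, m - 1)),
   that is, D_i G(i, m) = m alpha G(i + 1, m - 1) outside the integers.  Hence
   E_k g_n is a multiple of G(k, n - k), with coefficient 0 as soon as n < k.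

   For the density, put K(x) = x^{- alpha} - 1 on ]0, 1[.  The series in the
   characteristic function phi equals i s K^(s), so phi(s) (1 - i s K^(s)) = 1.
   Multiplying by the transform of the indicator of ]0, h[, Fourier uniqueness
   gives (K + 1_{]0, h[}) * g = tau_h K * g + 1_{]0, h[} almost everywhere, and
   letting h grow, (H + K) * g = H.  Convolving with a, and using
   a * (H + K) = H + H * beta, yields g + beta * g = a.  Iterating this renewal
   equation gives g = g_0 + ... + g_{k-1} almost everywhere on [0, k], because
   beta^{*k} * g vanishes there. *)
Require Import Defs.
From HB Require Import structures.
From mathcomp Require Import all_boot all_order all_algebra.
From mathcomp Require Import complex.
From mathcomp Require Import all_classical all_reals all_analysis.
From mathcomp Require Import measurable_realfun exponential_distribution.
From mathcomp Require Import ring lra.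

Import Order.TTheory GRing.Theory Num.Theory.
Import numFieldNormedType.Exports.

Local Open Scope classical_set_scope.
Local Open Scope ring_scope.

Set Implicit Arguments.
Unset Strict Implicit.
Unset Printing Implicit Defensive.

(** * Convolution of nonnegative functions *)

(** The operators must annihilate at every non-integer point, whereas convolutions of signed
    functions and Fourier uniqueness give almost everywhere statements. Signs are therefore set
    aside: with beta in place of b, Tonelli's theorem makes the algebra of convolutions hold at
    every point, with values in [0, +oo]. An identity (x - i) G = H * W then makes G finite at every
    point, and it carries the regularity too: H * W is continuous, so G is continuous off i; hence W
    is continuous off the integers, and H * W is differentiable there.

    The constant C_0 is the one for which a * x^{- alpha} = H, that is B(alpha, 1 - alpha) =
    Gamma(alpha) Gamma(1 - alpha); this is what makes a * (H + K) explicit.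

    The equation (H + K) * g = H cannot be transformed directly, because H is not integrable. Its
    substitute 1_{]0, h[} has transform (e^{ish} - 1) / (is), and the price of the truncation is
    exactly the term tau_h K * g, which vanishes on ]-oo, h]. *)

Section translation.
Context {R : realType}.
Local Notation mu := (@lebesgue_measure R).
Local Open Scope ereal_scope.

Lemma lebesgue_measureD (c : R) (A : set R) : measurable A ->
  pushforward mu ((fun x => x + c)%R : _ -> measurableTypeR R) A = mu A.
Proof.
move=> mA; apply/esym.
have mf : measurable_fun setT (fun x : R => x + c)%R by exact: measurable_funD.
apply: (@lebesgue_measure_unique _ (pushforward mu ((fun x => x + c)%R : _ ->
  measurableTypeR R))) => //= _ [[a b]] _ <-.
rewrite /pushforward/=.
have -> : (fun x : R => x + c)%R @^-1` `]a, b] = `](a - c)%R, (b - c)%R]%classic.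
  by apply/seteqP; split => x /=; rewrite !in_itv/= ltrBlDr lerBrDr.
rewrite !lebesgue_measure_itv/= !lte_fin ltrBlDr subrK.
by case: ifP => // _; rewrite -!EFinB; congr EFin; ring.
Qed.

Lemma ge0_integral_translation (f : R -> \bar R) (c : R) :
  measurable_fun [set: R] f -> (forall r, 0 <= f r) ->
  \int[mu]_x f (x + c)%R = \int[mu]_x f x.
Proof.
move=> mf f0.
have mt : measurable_fun setT ((fun x : R => x + c)%R : measurableTypeR R ->
  measurableTypeR R).
  exact: measurable_funD.
transitivity (\int[pushforward mu ((fun x => x + c)%R : _ -> measurableTypeR R)]_x f x).
  by rewrite ge0_integral_pushforward.
by apply: eq_measure_integral => //= A mA _; exact: lebesgue_measureD.
Qed.

Lemma ge0_integral_opp (f : R -> \bar R) :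
  measurable_fun [set: R] f -> (forall r, 0 <= f r) ->
  \int[mu]_x f (- x)%R = \int[mu]_x f x.
Proof.
move=> mf f0.
have mt : measurable_fun setT ((fun x : R => - x)%R : measurableTypeR R ->
  measurableTypeR R).
  exact: oppr_measurable.
transitivity (\int[pushforward mu (-%R : _ -> measurableTypeR R)]_x f x).
  by rewrite ge0_integral_pushforward.
by apply: eq_measure_integral => //= A mA _; exact: lebesgue_measureN.
Qed.

End translation.

Record nnfun (R : realType) := NNFun {
  nnf :> R -> \bar R;
  nnf_measurable : measurable_fun setT nnf;
  nnf_ge0 : forall x, (0 <= nnf x)%E }.

(** Locked so that simplification leaves the integral folded; [nnconvE] opens it. *)
HB.lock Definition convE (R : realType) (u v : nnfun R) (x : R) :=
  (\int[@lebesgue_measure R]_y (u y * v (x - y)%R))%E.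

Section nnfun_algebra.
Context {R : realType}.
Local Notation mu := (@lebesgue_measure R).
Local Open Scope ereal_scope.
Implicit Types u v w : nnfun R.

Lemma nnfunP u v : u =1 v -> u = v.
Proof.
case: u v => [u mu0 u0] [v mv v0] /= /funext uv; subst v.
by congr NNFun; exact: Prop_irrelevance.
Qed.

Lemma nnadd_subproof u v : measurable_fun setT (fun x => u x + v x) /\
  forall x, 0 <= u x + v x.
Proof.
split; first by apply: emeasurable_funD; exact: nnf_measurable.
by move=> x; rewrite adde_ge0 ?nnf_ge0.
Qed.
Definition nnadd u v := NNFun (nnadd_subproof u v).1 (nnadd_subproof u v).2.

Lemma nnmul_subproof u v : measurable_fun setT (fun x => u x * v x) /\
  forall x, 0 <= u x * v x.
Proof.
split; first by apply: emeasurable_funM; exact: nnf_measurable.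
by move=> x; rewrite mule_ge0 ?nnf_ge0.
Qed.
Definition nnmul u v := NNFun (nnmul_subproof u v).1 (nnmul_subproof u v).2.

(* The absolute value keeps the scaled function nonnegative for every [c]. *)
Lemma nnscale_subproof (c : R) u : measurable_fun setT (fun x => `|c|%:E * u x) /\
  forall x, 0 <= `|c|%:E * u x.
Proof.
split; first by apply: emeasurable_funM => //; exact: nnf_measurable.
by move=> x; rewrite mule_ge0 ?nnf_ge0 ?lee_fin.
Qed.
Definition nnscale c u := NNFun (nnscale_subproof c u).1 (nnscale_subproof c u).2.

Lemma nnshift_subproof (i : R) u : measurable_fun setT (fun x : R => u (x - i)%R) /\
  forall x, 0 <= u (x - i)%R.
Proof.
split; last by move=> x; exact: nnf_ge0.
apply: (measurableT_comp (nnf_measurable u)); exact: measurable_funB.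
Qed.
Definition nnshift i u := NNFun (nnshift_subproof i u).1 (nnshift_subproof i u).2.

Lemma measurable_conv_integrand u v :
  measurable_fun [set: R * R] (fun p => u p.2 * v (p.1 - p.2)%R).
Proof.
apply: emeasurable_funM.
  exact: (measurableT_comp (nnf_measurable u)).
by apply: (measurableT_comp (nnf_measurable v)); exact: measurable_funB.
Qed.

Lemma measurable_conv_integrand1 u v x :
  measurable_fun [set: R] (fun y => u y * v (x - y)%R).
Proof.
apply: emeasurable_funM; first exact: nnf_measurable.
by apply: (measurableT_comp (nnf_measurable v)); exact: measurable_funB.
Qed.

Lemma conv_integrand_ge0 u v x y : 0 <= u y * v (x - y)%R.
Proof. by rewrite mule_ge0 ?nnf_ge0. Qed.

Lemma nnconv_subproof u v : measurable_fun setT (convE u v) /\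
  forall x, 0 <= convE u v x.
Proof.
rewrite convE.unlock; split; last first.
  by move=> x; apply: integral_ge0 => y _; rewrite mule_ge0 ?nnf_ge0.
apply: (@measurable_fun_fubini_tonelli_F _ _ _ _ R mu _ (measurable_conv_integrand u v)).
by move=> p; rewrite mule_ge0 ?nnf_ge0.
Qed.
Definition nnconv u v := NNFun (nnconv_subproof u v).1 (nnconv_subproof u v).2.

Local Notation "u ** v" := (nnconv u v) (at level 40, left associativity).
Local Notation "u ++ v" := (nnadd u v).

Lemma nnshift_eq i u x : nnshift i u x = u (x - i)%R. Proof. by []. Qed.

Lemma nnconvE u v x : (u ** v) x = \int[mu]_y (u y * v (x - y)%R).
Proof. by rewrite /= convE.unlock. Qed.

Lemma nnconvC u v : u ** v = v ** u.
Proof.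
apply: nnfunP => x; rewrite !nnconvE.
have m1 := measurable_conv_integrand1 u v x.
have p1 := conv_integrand_ge0 u v x.
(* The substitution y -> x - y is made of the reflection y -> - y and the translation by - x. *)
rewrite -(ge0_integral_opp m1 p1).
rewrite -(@ge0_integral_translation _ _ (- x)%R); last 2 first.
- exact: (measurableT_comp m1).
- by move=> y; exact: p1.
apply: eq_integral => y _; rewrite muleC.
by congr (v _ * u _); ring.
Qed.

Lemma nnconvA u v w : u ** (v ** w) = u ** v ** w.
Proof.
apply: nnfunP => x; rewrite !nnconvE.
(* After the substitution z -> z - y in the inner integral, both sides are iterated integrals of
   this one function. *)
pose f (p : R * R) := u p.2 * (v (p.1 - p.2)%R * w (x - p.1)%R).
have mvw (y : R) : measurable_fun setT (fun z : R => v (z - y)%R * w (x - z)%R).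
  apply: emeasurable_funM.
    by apply: (measurableT_comp (nnf_measurable v)); exact: measurable_funB.
  by apply: (measurableT_comp (nnf_measurable w)); exact: measurable_funB.
have vw0 (y z : R) : 0 <= v (z - y)%R * w (x - z)%R by rewrite mule_ge0 ?nnf_ge0.
have mf : measurable_fun setT f.
  apply: emeasurable_funM; first exact: (measurableT_comp (nnf_measurable u)).
  apply: emeasurable_funM.
    by apply: (measurableT_comp (nnf_measurable v)); exact: measurable_funB.
  by apply: (measurableT_comp (nnf_measurable w)); exact: measurable_funB.
have f0 p : 0 <= f p by rewrite /f mule_ge0 ?nnf_ge0.
transitivity (\int[mu]_y \int[mu]_z f (z, y)).
  apply: eq_integral => y _.
  rewrite -[LHS]/(u y * (v ** w) (x - y)%R) nnconvE.
  rewrite -(@ge0_integral_translation _ _ (- y)%R); last 2 first.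
  - exact: measurable_conv_integrand1.
  - exact: conv_integrand_ge0.
  rewrite -ge0_integralZl; [|exact: measurableT| | |exact: nnf_ge0]; last 2 first.
  - have := mvw y; apply: eq_measurable_fun => z _ /=; congr (_ * w _).
    by rewrite opprB addrA addrNK.
  - by move=> z _; rewrite mule_ge0 ?nnf_ge0.
  by apply: eq_integral => z _; congr (_ * (v _ * w _)); rewrite /=; ring.
rewrite -(@fubini_tonelli _ _ _ _ R mu mu f mf f0).
apply: eq_integral => z _.
rewrite nnconvE -ge0_integralZr; last 4 first.
- exact: measurableT.
- exact: measurable_conv_integrand1.
- by move=> y _; exact: conv_integrand_ge0.
- exact: nnf_ge0.
by apply: eq_integral => y _; rewrite /f muleA.
Qed.

Lemma nnconvDr u v w : u ** (v ++ w) = u ** v ++ u ** w.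
Proof.
apply: nnfunP => x; rewrite -[RHS]/((u ** v) x + (u ** w) x) !nnconvE.
rewrite -ge0_integralD; last 5 first.
- exact: measurableT.
- by move=> y _; exact: conv_integrand_ge0.
- exact: measurable_conv_integrand1.
- by move=> y _; exact: conv_integrand_ge0.
- exact: measurable_conv_integrand1.
by apply: eq_integral => y _; rewrite ge0_muleDr ?nnf_ge0.
Qed.

Lemma nnconvDl u v w : (u ++ v) ** w = u ** w ++ v ** w.
Proof. by rewrite nnconvC nnconvDr !(nnconvC w). Qed.

Lemma nnconvZr c u v : u ** nnscale c v = nnscale c (u ** v).
Proof.
apply: nnfunP => x; rewrite -[RHS]/(`|c|%:E * (u ** v) x) !nnconvE.
rewrite -ge0_integralZl; last 4 first.
- exact: measurableT.
- exact: measurable_conv_integrand1.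
- by move=> y _; exact: conv_integrand_ge0.
- by rewrite lee_fin.
by apply: eq_integral => y _; rewrite /= muleCA.
Qed.

Lemma nnconvZl c u v : nnscale c u ** v = nnscale c (u ** v).
Proof. by rewrite nnconvC nnconvZr nnconvC. Qed.

Lemma nnconv_shiftr i u v : u ** nnshift i v = nnshift i (u ** v).
Proof.
apply: nnfunP => x; rewrite -[RHS]/((u ** v) (x - i)%R) !nnconvE.
by apply: eq_integral => y _; rewrite nnshift_eq; congr (_ * v _); ring.
Qed.

Lemma nnconvCA u v w : u ** (v ** w) = v ** (u ** w).
Proof. by rewrite !nnconvA (nnconvC v). Qed.

Lemma nnaddC u v : u ++ v = v ++ u.
Proof. by apply: nnfunP => x /=; rewrite addeC. Qed.

Lemma nnaddA u v w : u ++ (v ++ w) = (u ++ v) ++ w.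
Proof. by apply: nnfunP => x /=; rewrite addeA. Qed.

Lemma nnscaleE c u x : (0 <= c)%R -> nnscale c u x = c%:E * u x.
Proof. by move=> c0 /=; rewrite ger0_norm. Qed.

Lemma nnscaleDl c d u : (0 <= c)%R -> (0 <= d)%R ->
  nnscale (c + d) u = nnscale c u ++ nnscale d u.
Proof.
move=> c0 d0; apply: nnfunP => x.
by rewrite [RHS]/= !ger0_norm// nnscaleE ?addr_ge0// EFinD ge0_muleDl ?lee_fin.
Qed.

Lemma nnscaleA c d u : nnscale c (nnscale d u) = nnscale (c * d)%R u.
Proof. by apply: nnfunP => x /=; rewrite muleA -EFinM normrM. Qed.

End nnfun_algebra.
Notation "u ** v" := (nnconv u v) (at level 40, left associativity).

(** * Supports, multiplication by x - i, local integrability *)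

Section support.
Context {R : realType}.
Local Notation mu := (@lebesgue_measure R).
Local Open Scope ereal_scope.
Implicit Types u v w : nnfun R.

Definition nnreal (f : R -> R) (mf : measurable_fun setT f)
  (f0 : forall x, (0 <= f x)%R) : nnfun R :=
  NNFun (proj2 (measurable_EFinP setT f) mf)
        (fun x => eq_ind_r is_true (f0 x) (lee_fin 0 (f x))).

(** The endpoint is included: a value u x is later recovered from (x - i) u x, which says nothing at
    x = i. *)
Definition supp (i : R) u := forall x, (x <= i)%R -> u x = 0.

Lemma supp_le i j u : (j <= i)%R -> supp i u -> supp j u.
Proof. by move=> ji ui x xj; exact/ui/(le_trans xj). Qed.

Lemma supp_add i u v : supp i u -> supp i v -> supp i (nnadd u v).
Proof. by move=> ui vi x xi /=; rewrite ui// vi// adde0. Qed.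

Lemma supp_scale i c u : supp i u -> supp i (nnscale c u).
Proof. by move=> ui x xi /=; rewrite ui// mule0. Qed.

Lemma supp_shift i j u : supp i u -> supp (i + j) (nnshift j u).
Proof. by move=> ui x xi /=; rewrite ui// lerBlDr. Qed.

Lemma supp_conv i j u v : supp i u -> supp j v -> supp (i + j) (u ** v).
Proof.
move=> ui vj x xij; rewrite nnconvE integral0_eq// => y _.
have [yi|iy] := leP y i; first by rewrite ui// mul0e.
by rewrite vj ?mule0//; lra.
Qed.

Lemma measurable_step : measurable_fun setT (fun x : R => if (0 < x)%R then 1%R else
  0%R : R).
Proof. by apply: measurable_fun_ifT => //; exact: measurable_fun_ltr. Qed.

Lemma step_ge0 (x : R) : (0 <= if (0 < x)%R then 1%R else 0%R :> R)%R.
Proof. by case: ifP. Qed.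

(** The Heaviside function H; by [nnstep_convE], convolving with it is taking a primitive. *)
Definition nnstep : nnfun R := nnreal measurable_step step_ge0.

Lemma supp_step : supp 0 nnstep.
Proof. by move=> x x0 /=; rewrite ltNge x0. Qed.

Lemma nnstep_convE u x : (nnstep ** u) x = \int[mu]_(y in `]-oo, x[) u y.
Proof.
rewrite nnconvC nnconvE [RHS]integral_mkcond; apply: eq_integral => y _ /=.
rewrite patchE mem_setE in_itv/= subr_gt0.
by case: ifP => _; rewrite ?mule1 ?mule0.
Qed.

Lemma measurable_pospart (i : R) : measurable_fun setT (fun x : R => Num.max (x - i) 0)%R.
Proof. by apply: measurable_maxr => //; exact: measurable_funB. Qed.

Lemma pospart_ge0 (i x : R) : (0 <= Num.max (x - i) 0)%R.
Proof. by rewrite le_max lexx orbT. Qed.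

(* Multiplication by [x - i], meant for functions supported on [i, +oo[. *)
Definition nnX (i : R) u : nnfun R := nnmul (nnreal (measurable_pospart i)
  (@pospart_ge0 i)) u.

Lemma nnXE i u x : (i <= x)%R -> nnX i u x = (x - i)%:E * u x.
Proof. by move=> ix; rewrite /= (elimT max_idPl)// subr_ge0. Qed.

Lemma nnX_shift i j u : nnX (i + j) (nnshift j u) = nnshift j (nnX i u).
Proof.
apply: nnfunP => x /=; congr (_%:E * _); congr Num.max.
by rewrite opprD addrA addrAC.
Qed.

Lemma nnX_scale i c u : nnX i (nnscale c u) = nnscale c (nnX i u).
Proof. by apply: nnfunP => x /=; rewrite muleCA. Qed.

(** Under the integral, x - (i + j) = (y - i) + ((x - y) - j). Wherever u y and v (x - y) are both
    nonzero, y > i and x - y > j, so the positive parts in [nnX] are plain differences. *)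
Lemma nnX_conv i j u v : supp i u -> supp j v ->
  nnX (i + j) (u ** v) = nnadd (nnX i u ** v) (u ** nnX j v).
Proof.
move=> ui vj; apply: nnfunP => x.
rewrite -[LHS]/((Num.max (x - (i + j))%R 0%R)%:E * (u ** v) x).
rewrite -[RHS]/((nnX i u ** v) x + (u ** nnX j v) x) !nnconvE.
rewrite -ge0_integralD; last 5 first.
- exact: measurableT.
- by move=> y _; exact: conv_integrand_ge0.
- exact: measurable_conv_integrand1.
- by move=> y _; exact: conv_integrand_ge0.
- exact: measurable_conv_integrand1.
rewrite -ge0_integralZl; last 4 first.
- exact: measurableT.
- exact: measurable_conv_integrand1.
- by move=> y _; exact: conv_integrand_ge0.
- by rewrite lee_fin pospart_ge0.
apply: eq_integral => y _ /=.
have [yi|iy] := leP y i; first by rewrite ui// !(mul0e, mule0) adde0.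
have [xyj|jxy] := leP (x - y)%R j; first by rewrite vj// !mule0 adde0.
rewrite !(elimT max_idPl); [|lra..].
rewrite -muleA [in X in _ = _ + X]muleCA -ge0_muleDl ?lee_fin; [|lra..].
by congr (_ * _); rewrite -EFinD; congr EFin; ring.
Qed.

(** Integrability on every half-line ]-oo, x[, written with H so that it is handled by the algebra
    of convolutions. *)
Definition locint u := forall x, (nnstep ** u) x < +oo.

Lemma locint_add u v : locint u -> locint v -> locint (nnadd u v).
Proof. by move=> lu lv x; rewrite nnconvDr lte_add_pinfty ?lu ?lv. Qed.

Lemma locint_scale c u : locint u -> locint (nnscale c u).
Proof. by move=> lu x; rewrite nnconvZr lte_mul_pinfty ?lu ?lee_fin. Qed.

Lemma locint_shift i u : locint u -> locint (nnshift i u).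
Proof. by move=> lu x; rewrite nnconv_shiftr; exact: lu. Qed.

Lemma nnstep_conv_le u x y : (x <= y)%R -> (nnstep ** u) x <= (nnstep ** u) y.
Proof.
move=> xy; rewrite !nnstep_convE; apply: ge0_subset_integral => //.
- exact: measurable_funTS (nnf_measurable u).
- by move=> z _; exact: nnf_ge0.
- by apply: subset_itvl; rewrite bnd_simp.
Qed.

(** The bound is H * (u * v) <= (H * u) (H * v): in (H * u) * v at x only 0 < y < x contributes, and
    there H * u is at most its value at x. *)
Lemma locint_conv u v : supp 0 u -> supp 0 v ->
  locint u -> locint v -> locint (u ** v).
Proof.
move=> u0 v0 lu lv x; rewrite nnconvA.
apply: (@le_lt_trans _ _ ((nnstep ** u) x * (nnstep ** v) x)); last first.
  by rewrite lte_mul_pinfty ?nnf_ge0// ge0_fin_numE ?nnf_ge0.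
rewrite (nnconvE _ v) (nnconvE nnstep v) -ge0_integralZl; last 4 first.
- exact: measurableT.
- exact: measurable_conv_integrand1.
- by move=> y _; exact: conv_integrand_ge0.
- exact: nnf_ge0.
apply: ge0_le_integral.
- exact: measurableT.
- by move=> y _; exact: conv_integrand_ge0.
- exact: measurable_conv_integrand1.
- by apply: emeasurable_funM => //; exact: measurable_conv_integrand1.
move=> y _.
have su : supp 0 (nnstep ** u) by rewrite -(addr0 0%R); exact: supp_conv supp_step u0.
have [y0|y0] := leP y 0%R.
  by rewrite su// mul0e mule_ge0 ?nnf_ge0// conv_integrand_ge0.
have [xy|yx] := leP x y; first by rewrite v0 ?subr_le0// !mule0.
by rewrite /= y0 mul1e lee_wpmul2r ?nnf_ge0// nnstep_conv_le// ltW.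
Qed.

Lemma supp_iter_conv i u v m : supp 0 u -> supp i v ->
  supp i (iter m (nnconv u) v).
Proof.
move=> u0 vi; elim: m => //= m ih; rewrite -(add0r i); exact: supp_conv.
Qed.

Lemma locint_iter_conv u v m : supp 0 u -> supp 0 v -> locint u -> locint v ->
  locint (iter m (nnconv u) v).
Proof.
move=> u0 v0 lu lv; elim: m => //= m ih.
by apply: locint_conv => //; exact: supp_iter_conv.
Qed.

Lemma iter_convC u v w m :
  iter m (nnconv u) (v ** w) = v ** iter m (nnconv u) w.
Proof. by elim: m => //= m ->; rewrite nnconvCA. Qed.

(** A convolution of locally integrable functions is in general finite only almost everywhere. Here
    (x - i) u x is a value of H * w, hence finite, and dividing by x - i > 0 gives finiteness at
    every point, so that [fine] loses nothing. *)
Lemma fin_of_primitive i u w : supp i u -> locint w -> nnX i u = nnstep ** w ->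
  forall x, u x < +oo.
Proof.
move=> ui lw uw x; have [xi|ix] := leP x i; first by rewrite ui.
have : nnX i u x < +oo by rewrite uw; exact: lw.
rewrite nnXE ?ltW//; case: (u x) (nnf_ge0 u x) => //=.
  by move=> r _ _; rewrite ltry.
by move=> _; rewrite gt0_muley// lte_fin subr_gt0.
Qed.

End support.

(** * The operators annihilate the convolutions *)

Section dm_functions.
Context {R : realType} (alpha : R).
Hypotheses (alpha_gt0 : 0 < alpha) (alpha_lt1 : alpha < 1).
Local Notation mu := (@lebesgue_measure R).
Local Notation C0 := (dm_C0 alpha).

Lemma gamma_fun_ge0 (s : R) : 0 <= gamma_fun s.
Proof. by apply: Rintegral_ge0 => x _; rewrite mulr_ge0 ?powR_ge0 ?expR_ge0. Qed.

Lemma dm_C0_ge0 : 0 <= C0.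
Proof. by rewrite divr_ge0 ?mulr_ge0 ?gamma_fun_ge0. Qed.

(** Up to the factor 1 / Gamma(c), the kernel of fractional integration of order c. *)
Definition pow_density (c x : R) : R := if 0 < x then x `^ (c - 1) else 0.

Lemma measurable_pow_density c : measurable_fun setT (pow_density c).
Proof.
apply: measurable_fun_ifT => //; first exact: measurable_fun_ltr.
Qed.

Lemma pow_density_ge0 c x : 0 <= pow_density c x.
Proof. by rewrite /pow_density; case: ifP; rewrite ?powR_ge0. Qed.

Definition nnpow c := nnreal (measurable_pow_density c) (pow_density_ge0 c).

Lemma supp_nnpow c : supp 0 (nnpow c).
Proof. by move=> x x0 /=; rewrite /pow_density ltNge x0. Qed.

Lemma integral_powR_itv (c e x : R) : 0 < e -> e < x ->
  c != 0 -> (\int[mu]_(y in `[e, x]) (y `^ (c - 1))%:E = ((x `^ c - e `^ c) / c)%:E)%E.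
Proof.
move=> e0 ex c0.
have cpow (d : R) (y : R) : 0 < y -> {for y, continuous (fun z : R => z `^ d)}.
  move=> y0; apply: differentiable_continuous; apply/derivable1_diffP.
  by apply: derivable_powR; rewrite in_itv/= y0.
rewrite (@continuous_FTC2 _ (fun y => y `^ (c - 1)) (fun y => c^-1 * y `^ c)) //.
- by rewrite -EFinB -mulrBr mulrC.
- apply: continuous_in_subspaceT => y; rewrite inE/= in_itv/= => /andP[ey _].
  by apply: cpow; exact: lt_le_trans ey.
- split.
  + move=> y; rewrite in_itv/= => /andP[ey _].
    apply: derivableM => //; apply: derivable_powR.
    by rewrite in_itv/= andbT; exact: lt_trans ey.
  + apply: cvg_at_right_filter; apply: cvgM; [exact: cvg_cst|exact: cpow].
  + apply: cvg_at_left_filter; apply: cvgM; [exact: cvg_cst|apply: cpow].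
    exact: lt_trans ex.
- move=> y; rewrite in_itv/= => /andP[ey _].
  have y0 : 0 < y by exact: lt_trans ey.
  have h := is_derive1_powR c y0.
  have /(@derive_val _ _ _ _ _ _ _) := is_deriveZ c^-1 h.
  by rewrite derive1E => ->; rewrite /GRing.scale/= mulrA mulVf// mul1r.
Qed.

Lemma nnstep_conv_nnpow c : 0 < c -> nnstep ** nnpow c = nnscale c^-1 (nnpow (c + 1)).
Proof.
move=> c0; apply: nnfunP => x.
rewrite nnstep_convE nnscaleE ?invr_ge0 ?ltW// /= /pow_density.
have [x0|x0] := ltP 0 x; last first.
  rewrite mule0 integral0_eq// => y; rewrite /= in_itv/= => yx.
  by rewrite ltNge (ltW (lt_le_trans yx x0)).
rewrite addrK -EFinM.
(* For c < 1 the integrand blows up at 0, so ]0, x] is exhausted by segments away from 0. The index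
   starts at 2 because [integral_powR_itv] requires a left end strictly below x. *)
pose F (n : nat) := `[x / n.+2%:R, x]%classic : set R.
have F0 n : 0 < x / n.+2%:R by rewrite divr_gt0.
have Fx n : x / n.+2%:R < x by rewrite ltr_pdivrMr// ltr_pMr// ltr1n.
have UF : \bigcup_n F n = `]0, x]%classic.
  apply/seteqP; split => y /=.
    by case=> n _; rewrite /F/= !in_itv/= => /andP[ny ->]; rewrite (lt_le_trans _ ny).
  rewrite in_itv/= => /andP[y0 yx].
  exists (Num.truncn (x / y)) => //; rewrite /F/= in_itv/= yx andbT.
  rewrite ler_pdivrMr// mulrC -ler_pdivrMr//.
  have := truncnS_gt (x / y); move=> /ltW /le_trans; apply.
  by rewrite ler_nat.
have mpow : measurable_fun setT (fun y : R => (y `^ (c - 1))%:E).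
  by apply/measurable_EFinP; exact: measurable_powR.
have cvg1 : (\int[mu]_(y in F n) (y `^ (c - 1))%:E @[n --> \oo] -->
    \int[mu]_(y in `]0%R, x]) (y `^ (c - 1))%:E)%E.
  rewrite -UF; apply: ge0_nondecreasing_set_cvg_integral.
  - apply/nondecreasing_seqP => n; rewrite subsetEset => y; rewrite /F/= !in_itv/=.
    move=> /andP[h ->]; rewrite andbT; apply: le_trans h.
    by rewrite ler_pM2l// lef_pV2 ?posrE// ler_nat.
  - by move=> n; exact: measurable_itv.
  - by move=> n; exact: measurable_funTS mpow.
  - by move=> n y _; rewrite lee_fin powR_ge0.
have cvg2 : (\int[mu]_(y in F n) (y `^ (c - 1))%:E @[n --> \oo] -->
    (c^-1 * (x `^ c - 0))%:E)%E.
  apply: (@cvg_trans _ ((((x `^ c - (x / n.+2%:R) `^ c) / c)%:E) @[n --> \oo])).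
    by apply: near_eq_cvg; near=> n; rewrite /F integral_powR_itv// gt_eqF.
  apply: cvg_EFin; first by near=> n.
  under eq_fun do rewrite mulrC.
  apply: cvgM; first exact: cvg_cst.
  apply: cvgB; first exact: cvg_cst.
  have /cvg_at_rightP := powR_cvg0 c0; apply; split => //.
  rewrite -(mulr0 x); apply: cvgM; first exact: cvg_cst.
  by have := @cvg_harmonic R; rewrite -cvg_shiftS.
rewrite -[X in (_ * X)%:E]subr0 -(cvg_unique _ cvg1 cvg2)//.
rewrite -integral_itv_bndo_bndc; last exact: measurable_funTS mpow.
rewrite [LHS]integral_mkcond [RHS]integral_mkcond; apply: eq_integral => y _.
have mE (i : interval R) : (y \in [set` i]) = (y \in i) 
  by apply/idP/idP => [/set_mem//|h]; exact: mem_set.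
rewrite !patchE !mE !in_itv/=; case: ltP => /= y0.
  by case: ifP.
by rewrite andbF.
Unshelve. all: by end_near. Qed.

Lemma locint_nnpow c : 0 < c -> locint (nnpow c).
Proof. by move=> c0 x; rewrite nnstep_conv_nnpow//= -EFinM ltry. Qed.

Lemma nnX_nnpow c : 0 < c -> nnX 0 (nnpow c) = nnscale c (nnstep ** nnpow c).
Proof.
move=> c0; rewrite nnstep_conv_nnpow// nnscaleA mulfV ?gt_eqF//.
apply: nnfunP => x; have [x0|x0] := leP x 0.
  rewrite [LHS]/= [RHS]/= /pow_density ltNge x0/=; rewrite !mule0//.
rewrite nnXE ?ltW// nnscaleE// mul1e /= /pow_density x0 subr0 addrK -EFinM.
by rewrite mulr_powRB1// ltW.
Qed.

Definition nna : nnfun R := nnscale C0 (nnpow alpha).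

Lemma dm_aE x : (dm_a alpha x)%:E = nna x.
Proof.
rewrite /nna nnscaleE ?dm_C0_ge0//= /pow_density /dm_a -EFinM.
by case: ifP => //; rewrite mulr0.
Qed.

Lemma supp_nna : supp 0 nna.
Proof. exact/supp_scale/supp_nnpow. Qed.

Lemma locint_nna : locint nna.
Proof. exact/locint_scale/locint_nnpow. Qed.

Lemma nnX_nna : nnX 0 nna = nnscale alpha (nnstep ** nna).
Proof.
by rewrite /nna nnX_scale nnX_nnpow// nnconvZr !nnscaleA mulrC.
Qed.

Lemma measurable_dm_b : measurable_fun setT (fun x => - dm_b alpha x).
Proof.
apply: (@eq_measurable_fun _ _ _ _ setT (fun x : R => if 1 < x then
    C0 * ((x - 1) `^ alpha * x `^ (-1)) else 0)).
  move=> x _; rewrite /dm_b; case: ifP => [x1|]; last by rewrite oppr0.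
  by rewrite mulNr opprK powR_inv1// ltW// (lt_trans _ x1).
apply: measurable_fun_ifT => //; first exact: measurable_fun_ltr.
apply: measurable_funM => //; apply: measurable_funM; last exact: measurable_powR.
by apply: (measurableT_comp (measurable_powR _)); exact: measurable_funB.
Qed.

Lemma dm_b_le0 x : 0 <= - dm_b alpha x.
Proof.
rewrite /dm_b; case: ifP => [x1|_]; last by rewrite oppr0.
rewrite mulNr opprK mulr_ge0 ?dm_C0_ge0// divr_ge0 ?powR_ge0//; lra.
Qed.

Definition nnb : nnfun R := nnreal measurable_dm_b dm_b_le0.

Lemma supp_nnb : supp 1 nnb.
Proof. by move=> x x1 /=; rewrite /dm_b ltNge x1/= oppr0. Qed.

Lemma supp0_nnb : supp 0 nnb.
Proof. by apply: supp_le supp_nnb. Qed.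

(** For x > 1 both sides are C_0 (x - 1)^alpha: the denominator x in b is there to be cancelled. *)
Lemma nnX_nnb : nnX 0 nnb = nnscale alpha (nnstep ** nnshift 1 nna).
Proof.
rewrite nnconv_shiftr /nna nnconvZr nnstep_conv_nnpow//.
apply: nnfunP => x; have [x1|x1] := leP x 1.
  rewrite /= /dm_b /pow_density subr_gt0 ltNge x1/= oppr0 !mule0//.
rewrite nnXE ?(le_trans _ (ltW x1))//.
rewrite /= /dm_b /pow_density subr_gt0 x1 addrK subr0 !ger0_norm ?dm_C0_ge0 ?invr_ge0
  ?ltW//.
have xn0 : x != 0 by rewrite gt_eqF// (lt_trans _ x1).
by rewrite -!EFinM; congr EFin; field; rewrite xn0 gt_eqF.
Qed.

Lemma locint_nnb : locint nnb.
Proof.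
move=> x; have x0 : 0 <= Num.max x 0 by rewrite le_max lexx orbT.
(* The majorant is C_0 z^alpha: for z > 1, (z - 1)^alpha <= z^alpha and 1 / z <= 1. *)
pose u : nnfun R := nnscale C0 (nnpow (alpha + 1)).
have lu : locint u by apply/locint_scale/locint_nnpow/addr_gt0.
apply: le_lt_trans (lu x); rewrite !nnconvE; apply: ge0_le_integral.
- exact: measurableT.
- by move=> y _; exact: conv_integrand_ge0.
- exact: measurable_conv_integrand1.
- exact: measurable_conv_integrand1.
move=> y _; rewrite lee_wpmul2l ?nnf_ge0//; move: (x - y) => {y} z.
have [z1|z1] := leP z 1; first by rewrite supp_nnb ?nnf_ge0.
have z0 : 0 < z by exact: lt_trans z1.
rewrite nnscaleE ?dm_C0_ge0//= /dm_b z1 /pow_density z0 addrK -EFinM lee_fin.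
rewrite mulNr opprK ler_wpM2l ?dm_C0_ge0// ler_pdivrMr//.
apply: (@le_trans _ _ (z `^ alpha)); last by rewrite ler_peMr ?powR_ge0// ltW.
by apply: ge0_ler_powR; rewrite ?nnegrE ?ltW//; lra.
Qed.

End dm_functions.

(** * Continuity and derivative of H * w *)

Section primitive.
Context {R : realType}.
Local Notation mu := (@lebesgue_measure R).
Variable w : nnfun R.
Hypotheses (w0 : supp 0 w) (lw : locint w) (fw : forall x, (w x < +oo)%E).

Let fineK_w x : (fine (w x))%:E = w x.
Proof. by rewrite fineK// ge0_fin_numE ?nnf_ge0. Qed.

Lemma measurable_fine_nnfun : measurable_fun setT (fun x => fine (w x)).
Proof.
apply/measurable_EFinP; apply: eq_measurable_fun (nnf_measurable w) => x _ /=.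
by rewrite fineK_w.
Qed.

Lemma integrable_fine_nnfun a b : mu.-integrable `[a, b] (EFin \o (fun x => fine (w x))).
Proof.
apply/integrableP; split.
  by apply/measurable_EFinP; exact: measurable_funTS measurable_fine_nnfun.
apply: le_lt_trans (lw (b + 1)); rewrite nnstep_convE.
under eq_integral do rewrite /= -abse_EFin fineK_w gee0_abs ?nnf_ge0//.
apply: ge0_subset_integral => //.
- exact: measurable_funTS (nnf_measurable w).
- by move=> z _; exact: nnf_ge0.
- by move=> z /=; rewrite !in_itv/= => /andP[_ zb]; lra.
Qed.

Definition primitive (x : R) : R := fine ((nnstep ** w) x).

(** Since w vanishes up to 0, every base point a <= 0 gives the same integral. This freedom places x
    in the interior of a segment [a, b], also when x <= 0. *)
Lemma primitiveE a x : a <= 0 -> primitive x = \int[mu]_(t in `[a, x]) fine (w t).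
Proof.
move=> a0; rewrite /primitive /Rintegral; congr fine.
rewrite nnstep_convE -integral_itv_bndo_bndc; last first.
  by apply/measurable_EFinP; exact: measurable_funTS measurable_fine_nnfun.
rewrite [LHS]integral_mkcond [RHS]integral_mkcond; apply: eq_integral => y _.
have mE (i : interval R) : (y \in [set` i]) = (y \in i).
  by apply/idP/idP => [/set_mem//|h]; exact: mem_set.
rewrite !patchE !mE !in_itv/= fineK_w; case: (ltP y x) => /= yx; last by rewrite andbF.
by rewrite andbT; case: leP => // ya; rewrite w0//; lra.
Qed.

Lemma primitive_continuous : continuous primitive.
Proof.
move=> x; pose a := Num.min 0 x - 1; pose b := x + 1.
have a0 : a <= 0 by rewrite /a lerBlDr ge_min; apply/orP; left; lra.
have ax : a < x by rewrite /a ltrBlDr gt_min; apply/orP; right; lra.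
have xb : x < b by rewrite /b; lra.
have := parameterized_integral_continuous (ltW (lt_trans ax xb)) (integrable_fine_nnfun
  a b).
move=> /continuous_within_itvP => /(_ (lt_trans ax xb))[+ _ _] => /(_ x).
rewrite in_itv/= ax xb => /(_ isT).
suff -> : primitive = fun y => parameterized_integral mu a y (fun t => fine (w t)) by [].
by apply/funext => y; rewrite (@primitiveE a).
Qed.

Lemma primitive_derive x : {for x, continuous (fun x => fine (w x))} ->
  is_derive x 1 primitive (fine (w x)).
Proof.
move=> cx; pose a := Num.min 0 x - 1; pose b := x + 1.
have a0 : a <= 0 by rewrite /a lerBlDr ge_min; apply/orP; left; lra.
have ax : a < x by rewrite /a ltrBlDr gt_min; apply/orP; right; lra.
have xb : x < b by rewrite /b; lra.
have -> : primitive = fun y => \int[mu]_(t in `[a, y]) fine (w t).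
  by apply/funext => y; rewrite (@primitiveE a).
have [d e] := continuous_FTC1_closed xb (integrable_fine_nnfun a b) ax cx.
by split; [exact: d|rewrite -derive1E; exact: e].
Qed.

End primitive.

Section dm_convolutions.
Context {R : realType} (alpha : R).
Hypotheses (alpha_gt0 : 0 < alpha) (alpha_lt1 : alpha < 1).
Local Notation mu := (@lebesgue_measure R).
Local Notation a := (nna alpha).
Local Notation b := (nnb alpha).
Local Notation a1 := (nnshift 1 a).

(* In the notation of the header, with [nnb] for beta and [a1] for tau_1 a,
   [nnG i m] is G(i, m). *)
Definition nnq (i : nat) := iter i (nnconv a1) a.
Definition nnG (i m : nat) := iter m (nnconv b) (nnq i).

Let supp_a1 : supp 1 a1.
Proof. by have := @supp_shift _ 0 1 _ (@supp_nna _ alpha); rewrite add0r. Qed.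
Let supp0_a1 : supp 0 a1. Proof. exact: supp_le supp_a1. Qed.

Lemma supp_nnq i : supp i%:R (nnq i).
Proof.
elim: i => [|i ih]; first exact: supp_nna.
rewrite (_ : i.+1%:R = 1 + i%:R); last by rewrite -natr1 addrC.
exact: supp_conv.
Qed.

Lemma supp_nnG i m : supp i%:R (nnG i m).
Proof. by apply: supp_iter_conv; [exact: supp0_nnb|exact: supp_nnq]. Qed.

Lemma supp0_nnG i m : supp 0 (nnG i m).
Proof. exact: supp_le (ler0n _ i) (@supp_nnG i m). Qed.

Lemma locint_nnG i m : locint (nnG i m).
Proof.
apply: locint_iter_conv; [exact: supp0_nnb| |exact: locint_nnb|].
  exact: supp_le (ler0n _ i) (@supp_nnq i).
apply: locint_iter_conv; [exact: supp0_a1|exact: supp_nna| |exact: locint_nna].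
exact/locint_shift/locint_nna.
Qed.

(** Each of the i + 1 factors (one a and i copies of tau_1 a), multiplied by the distance to the
    left end of its support, yields alpha times H convolved with itself. *)
Lemma nnX_nnq i : nnX i%:R (nnq i) = nnscale (i.+1%:R * alpha) (nnstep ** nnq i).
Proof.
elim: i => [|i ih]; first by rewrite mul1r nnX_nna.
have := nnX_conv supp_a1 (@supp_nnq i); rewrite ih (_ : 1 + i%:R = i.+1%:R); last first.
  by rewrite -addn1 natrD addrC.
move=> ->.
have -> : nnX 1 a1 = nnshift 1 (nnX 0 a) by rewrite -nnX_shift add0r.
rewrite nnX_nna//.
have -> : nnshift 1 (nnscale alpha (nnstep ** a)) = nnscale alpha (nnstep ** a1).
  by rewrite nnconv_shiftr; exact: nnfunP.
rewrite nnconvZl nnconvZr nnconvCA -nnconvA -nnscaleDl ?mulr_ge0 ?(ltW alpha_gt0)//.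
by congr nnscale; rewrite -[i.+2%:R]natr1; ring.
Qed.

Lemma a1_conv_nnG i m : a1 ** nnG i m = nnG i.+1 m.
Proof. by rewrite /nnG -iter_convC. Qed.

(** The function whose primitive is (x - i) G(i, m). At m = 0 the predecessor is harmless, its
    coefficient being 0. *)
Definition nnW i m := nnadd (nnscale (i.+1%:R * alpha) (nnG i m))
  (nnscale (m%:R * alpha) (nnG i.+1 m.-1)).

Lemma nnX_nnG i m : nnX i%:R (nnG i m) = nnstep ** nnW i m.
Proof.
rewrite /nnW nnconvDr !nnconvZr.
elim: m => [|m ih].
  rewrite nnX_nnq; apply: nnfunP => x /=.
  by rewrite mul0r normr0 mul0e adde0.
(* Although beta lives on [1, +oo[, it is weighted by x and not by x - 1, because x beta is the
   explicit one; this trades a factor beta for alpha H * tau_1 a. Hence the weight x - i of G(i, m)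
   does not depend on m. *)
have := nnX_conv (@supp0_nnb _ alpha) (@supp_nnG i m); rewrite add0r ih => ->.
rewrite nnX_nnb// nnconvZl -nnconvA a1_conv_nnG nnconvDr !nnconvZr.
rewrite !(nnconvCA b).
(* For m = 0 both sides vanish; for m > 0 the two convolutions are the same by definition. *)
have -> : nnscale (m%:R * alpha) (nnstep ** (b ** nnG i.+1 m.-1)) =
    nnscale (m%:R * alpha) (nnstep ** nnG i.+1 m).
  case: {+}m => [|m'] //; apply: nnfunP => x /=.
  by rewrite mul0r normr0 !mul0e.
have -> : m.+1%:R * alpha = alpha + m%:R * alpha by rewrite -natr1; ring.
rewrite nnscaleDl ?mulr_ge0 ?(ltW alpha_gt0)//= !nnaddA; congr nnadd.
by rewrite nnaddC.
Qed.

Lemma nnG_fin i m x : (nnG i m x < +oo)%E.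
Proof.
apply: (fin_of_primitive (@supp_nnG i m) _ (nnX_nnG i m)).
by apply: locint_add; apply: locint_scale; exact: locint_nnG.
Qed.

Lemma nnG_fineK i m x : (fine (nnG i m x))%:E = nnG i m x.
Proof. by rewrite fineK// ge0_fin_numE ?nnf_ge0 ?nnG_fin. Qed.

Definition Gr i m x := fine (nnG i m x).

Lemma supp_Gr i m x : x <= i%:R -> Gr i m x = 0.
Proof. by move=> xi; rewrite /Gr supp_nnG. Qed.

Lemma supp0_nnW i m : supp 0 (nnW i m).
Proof. by apply: supp_add; apply: supp_scale; exact: supp0_nnG. Qed.

Lemma locint_nnW i m : locint (nnW i m).
Proof. by apply: locint_add; apply: locint_scale; exact: locint_nnG. Qed.

Lemma nnWE i m x : nnW i m x =
  (i.+1%:R * alpha * Gr i m x + m%:R * alpha * Gr i.+1 m.-1 x)%:E.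
Proof.
rewrite -[LHS]/(nnadd _ _ x)/= !ger0_norm ?mulr_ge0 ?(ltW alpha_gt0)//.
by rewrite -(nnG_fineK i m) -(nnG_fineK i.+1) -!EFinM -EFinD.
Qed.

Lemma nnW_fin i m x : (nnW i m x < +oo)%E.
Proof. by rewrite nnWE ltry. Qed.

Lemma mulX_Gr i m : (fun x => (x - i%:R) * Gr i m x) = primitive (nnW i m).
Proof.
apply/funext => x; rewrite /primitive -nnX_nnG.
have [xi|ix] := leP x i%:R.
  by rewrite supp_Gr// mulr0 /= supp_nnG// mule0.
by rewrite nnXE ?ltW// -nnG_fineK -EFinM.
Qed.

(** The function (z - i) G(i, m) z is a primitive, hence continuous, and i is the only point where
    dividing by z - i fails. This continuity is what [Gr_derive] needs to differentiate the same
    primitive. *)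
Lemma Gr_continuous i m (x : R) : x != i%:R -> {for x, continuous (Gr i m)}.
Proof.
move=> xi.
have c : {for x, continuous (fun z : R => (z - i%:R)^-1 * ((z - i%:R) * Gr i m z))}.
  apply: cvgM.
    by apply: cvgV; [rewrite subr_eq0|apply: cvgB; [exact: cvg_id|exact: cvg_cst]].
  have cp := primitive_continuous (@supp0_nnW i m) (@locint_nnW i m) (@nnW_fin i m).
  by rewrite -mulX_Gr in cp; exact: cp.
rewrite /continuous_at in c *.
have e : {near x, (fun z : R => (z - i%:R)^-1 * ((z - i%:R) * Gr i m z)) =1 Gr i m}.
  near=> z; rewrite mulrA mulVf ?mul1r// subr_eq0.
  near: z; have : 0 < `|x - i%:R| by rewrite normr_gt0 subr_eq0.
  move=> /(@nbhsx_ballx _ R^o x) ; apply: filterS => z; rewrite /ball/=.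
  by apply: contraTneq => ->; rewrite ltxx.
have c' : (z - i%:R)^-1 * ((z - i%:R) * Gr i m z) @[z --> x] --> Gr i m x.
  have := c; rewrite /prop_for/= [X in _ --> X](_ : _ = Gr i m x) => [h|]; first exact: h.
  by rewrite mulrA mulVf ?mul1r// subr_eq0.
apply: cvg_trans c'; apply: near_eq_cvg.
by apply: filterS e => z ->.
Unshelve. all: by end_near. Qed.

Definition nonint : set R := [set x | x \isn't a Num.int].

Lemma nonint_neq x (i : nat) : nonint x -> x != i%:R.
Proof. by apply: contraNneq => ->; exact: natr_int. Qed.

Lemma Gr_derive i m x : nonint x ->
  is_derive x 1 (fun z => (z - i%:R) * Gr i m z)
    (i.+1%:R * alpha * Gr i m x + m%:R * alpha * Gr i.+1 m.-1 x).
Proof.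
move=> nx; rewrite mulX_Gr.
have -> : i.+1%:R * alpha * Gr i m x + m%:R * alpha * Gr i.+1 m.-1 x = fine (nnW i m x).
  by rewrite nnWE.
apply: primitive_derive.
- exact: supp0_nnW.
- exact: locint_nnW.
- exact: nnW_fin.
have -> : (fun x => fine (nnW i m x)) =
    (fun x => i.+1%:R * alpha * Gr i m x + m%:R * alpha * Gr i.+1 m.-1 x).
  by apply/funext => z; rewrite nnWE.
by apply: cvgD; (apply: cvgM; [exact: cvg_cst|exact/Gr_continuous/nonint_neq]).
Qed.

Lemma nonint_open : open nonint.
Proof.
rewrite openE => x nx.
have := floor_itv x; rewrite le_eqVlt => /andP[/predU1P[h|h1 h2]].
  by move: nx; rewrite /nonint/= -h intr_int.
apply: (@filterS _ (nbhs x) _ `](Num.floor x)%:~R, (Num.floor x + 1)%:~R[); last first.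
  by apply: near_in_itvoo; rewrite in_itv/= h1 h2.
move=> z /=; rewrite in_itv/= => /andP[h3 h4]; apply/negP => /intrP[m zm].
by move: h3 h4; rewrite zm !ltr_int ltzD1 => /lt_geF ->.
Qed.

(** F j is the candidate for E_j f. The derivative in D_j depends on values around x, so the
    equality has to be carried by induction on an open set and not at a single point. *)
Lemma opE_chain (k : nat) (f : R -> R) (F : nat -> R -> R) (U : set R) :
  open U -> (forall x, U x -> f x = F 0 x) ->
  (forall j x, (j < k)%N -> U x -> is_derive x 1 (fun z => (z - j%:R) * F j z)
     (F j.+1 x + j.+1%:R * alpha * F j x)) ->
  forall j, (j <= k)%N -> forall x, U x -> opE alpha j f x = F j x.
Proof.
move=> oU fF dF; elim => [|j ih] jk x Ux; first exact: fF.
have nU : nbhs x U by exact: open_nbhs_nbhs.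
have e : {near x, (fun z => (z - j%:R) * F j z) =1 (fun z => (z - j%:R) * opE alpha j f
  z)}.
  by apply: filterS nU => z Uz; rewrite ih// ltnW.
rewrite /= /opD ih ?(ltnW jk)// derive1E -(near_eq_derive _ e) ?oner_neq0//.
have d := dF j x jk Ux; rewrite derive_val; ring.
Qed.

Lemma opE_chain_annihilates (k : nat) (f : R -> R) (F : nat -> R -> R) (U : set R) :
  open U -> (forall x, U x -> f x = F 0 x) ->
  (forall j x, (j < k)%N -> U x -> is_derive x 1 (fun z => (z - j%:R) * F j z)
     (F j.+1 x + j.+1%:R * alpha * F j x)) ->
  (forall x, U x -> F k x = 0) ->
  forall x, U x -> opE_annihilates_at alpha k f x.
Proof.
move=> oU fF dF Fk x Ux; have c := opE_chain oU fF dF.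
split; last by rewrite c// Fk.
move=> j jk; have nU : nbhs x U by exact: open_nbhs_nbhs.
have e : {near x, (fun z => (z - j%:R) * F j z) =1 (fun z => (z - j%:R) * opE alpha j f
  z)}.
  by apply: filterS nU => z Uz; rewrite c// ltnW.
have [d _] := dF j x jk Ux.
exact: near_eq_derivable e d.
Qed.

(* The value of E_j g_n. *)
Definition dmF (n j : nat) (x : R) : R :=
  (-1) ^+ n * alpha ^+ j * (n ^_ j)%:R * Gr j (n - j) x.

(** D_j contributes the factor (n - j) alpha at each stage, whence the power of alpha and the
    falling factorial in [dmF]; the latter is 0 from j = n + 1 on. *)
Lemma dmF_derive n j x : nonint x ->
  is_derive x 1 (fun z => (z - j%:R) * dmF n j z)
    (dmF n j.+1 x + j.+1%:R * alpha * dmF n j x).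
Proof.
move=> nx; have h := Gr_derive j (n - j) nx.
have := is_deriveZ ((-1) ^+ n * alpha ^+ j * (n ^_ j)%:R) h.
have -> : ((-1) ^+ n * alpha ^+ j * (n ^_ j)%:R) \*: (fun z => (z - j%:R) * Gr j (n -
  j) z) =
    (fun z => (z - j%:R) * dmF n j z).
  by apply/funext => z; rewrite /dmF /= /GRing.scale/=; ring.
move=> /is_derive_eq; apply.
by rewrite /dmF ffactnSr natrM exprSr subnS /GRing.scale/=; ring.
Qed.

Lemma dmF_last n j x : (n < j)%N -> dmF n j x = 0.
Proof. by move=> nj; rewrite /dmF ffact_small// mulr0 mul0r. Qed.

End dm_convolutions.

Section dm_g_convolution.
Context {R : realType} (alpha : R).
Hypotheses (alpha_gt0 : 0 < alpha) (alpha_lt1 : alpha < 1).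
Local Notation mu := (@lebesgue_measure R).
Local Notation a := (nna alpha).
Local Notation b := (nnb alpha).
Local Notation a1 := (nnshift 1 a).

(** beta^{*(m + 1)}, with the index shift of [conv_powS]. *)
Definition nnbpow (m : nat) := iter m (nnconv b) b.

Lemma supp0_nnbpow m : supp 0 (nnbpow m).
Proof. by apply: supp_iter_conv; exact: supp0_nnb. Qed.

Let supp0_a1 : supp 0 a1.
Proof.
have := @supp_shift _ 0 1 _ (@supp_nna _ alpha); rewrite add0r.
by apply: supp_le; exact: ler01.
Qed.

(** Multiplication by x is a derivation, and it turns any of the m + 1 factors beta into alpha H *
    tau_1 a. The identity serves to show that the powers of beta are finite everywhere. *)
Lemma nnX_nnbpow m : nnX 0 (nnbpow m) =
  nnscale (m.+1%:R * alpha) (nnstep ** iter m (nnconv b) a1).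
Proof.
elim: m => [|m ih]; first by rewrite mul1r nnX_nnb.
have := nnX_conv (@supp0_nnb _ alpha) (@supp0_nnbpow m); rewrite addr0 ih => ->.
rewrite nnX_nnb// nnconvZl nnconvZr -!nnconvA (nnconvCA b) -[a1 ** _]iter_convC.
rewrite [b ** iter m _ a1]/(iter m.+1 (nnconv b) a1).
have -> : iter m (nnconv b) (a1 ** b) = iter m.+1 (nnconv b) a1.
  by rewrite iterSr nnconvC.
rewrite -nnscaleDl ?mulr_ge0 ?(ltW alpha_gt0)//.
by congr nnscale; rewrite -[m.+2%:R]natr1; ring.
Qed.

Lemma nnbpow_fin m x : (nnbpow m x < +oo)%E.
Proof.
apply: (fin_of_primitive (w := nnscale (m.+1%:R * alpha) (iter m (nnconv b) a1))
  (@supp0_nnbpow m)).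
  apply: locint_scale; apply: locint_iter_conv; [exact: supp0_nnb|exact: supp0_a1|
    exact: locint_nnb|].
  exact/locint_shift/locint_nna.
by rewrite nnX_nnbpow nnconvZr.
Qed.

(** The bridge between real integrals, as in [convolution], and extended ones; finiteness makes it
    valid, and c carries the signs (-1)^m. *)
Lemma Rintegral_nnconv (u v : nnfun R) (f g : R -> R) (c x : R) :
  (forall y, (f y)%:E = u y) -> (forall y, (g y)%:E = v y) ->
  ((u ** v) x < +oo)%E ->
  \int[mu]_y (f y * (c * g (x - y))) = c * fine ((u ** v) x).
Proof.
move=> fu gv uv; rewrite nnconvE.
under eq_Rintegral do rewrite mulrCA.
have e : \int[mu]_y (f y * g (x - y)) = fine (\int[mu]_y (u y * v (x - y)%R))%E.
  by rewrite /Rintegral; congr fine; apply: eq_integral => y _; rewrite EFinM fu gv.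
rewrite RintegralZl//; first by rewrite e.
apply/integrableP; split.
  apply: eq_measurable_fun (measurable_conv_integrand1 u v x) => y _ /=.
  by rewrite EFinM fu gv.
move: uv; rewrite nnconvE; apply: le_lt_trans.
rewrite le_eqVlt; apply/orP; left; apply/eqP; apply: eq_integral => y _.
by rewrite -[RHS]gee0_abs ?conv_integrand_ge0// -fu -gv -EFinM.
Qed.

Lemma conv_powS_dm_b m x :
  conv_powS (dm_b alpha) m x = (-1) ^+ m.+1 * fine (nnbpow m x).
Proof.
elim: m x => [|m ih] x; first by rewrite /= expr1 mulN1r opprK.
rewrite /= /convolution.
transitivity (\int[mu]_y ((- dm_b alpha y) * ((-1) ^+ m.+2 * fine (nnbpow m (x - y))))).
  by apply: eq_Rintegral => y _; rewrite ih [in RHS]exprS; ring.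
rewrite (@Rintegral_nnconv b (nnbpow m) (fun y => - dm_b alpha y) (fun y => fine
  (nnbpow m y)))//.
  by move=> y; rewrite fineK// ge0_fin_numE ?nnf_ge0 ?nnbpow_fin.
exact: nnbpow_fin m.+1 x.
Qed.

Lemma dm_gE n x : dm_g alpha n x = (-1) ^+ n * Gr alpha 0 n x.
Proof.
case: n => [|n].
  by rewrite expr0 mul1r /Gr -[fine _]/(fine (nna alpha x)) -dm_aE.
(* [nnG] has the factor a innermost, [dm_g] has it outermost. *)
have e : nnG alpha 0 n.+1 = a ** nnbpow n.
  by rewrite /nnG /nnq iterSr [LHS]/= nnconvC iter_convC.
rewrite /= /convolution /Gr e -(@Rintegral_nnconv a (nnbpow n) (dm_a alpha) (fun y =>
  fine (nnbpow n y)))//.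
- by apply: eq_Rintegral => y _; rewrite conv_powS_dm_b.
- by move=> y; rewrite dm_aE.
- by move=> y; rewrite fineK// ge0_fin_numE ?nnf_ge0 ?nnbpow_fin.
- by rewrite -e; exact: nnG_fin.
Qed.

Lemma dmF0 n x : dmF alpha n 0 x = dm_g alpha n x.
Proof. by rewrite dm_gE /dmF subn0 expr0 !mulr1. Qed.

Lemma dm_g_annihilated k j x : (j < k)%N -> nonint x ->
  opE_annihilates_at alpha k (dm_g alpha j) x.
Proof.
move=> jk; apply: (@opE_chain_annihilates _ _ k _ (dmF alpha j)).
- exact: nonint_open.
- by move=> z _; rewrite dmF0.
- by move=> i z _ nz; exact: dmF_derive.
- by move=> z _; exact: dmF_last.
Qed.

End dm_g_convolution.

(** * From the renewal equation to the density *)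

Section conv_ae.
Context {R : realType}.
Local Notation mu := (@lebesgue_measure R).
Local Open Scope ereal_scope.
Implicit Types u v w : nnfun R.

Lemma ae_imp (P Q : R -> Prop) : (forall x, P x -> Q x) ->
  {ae mu, forall x, P x} -> {ae mu, forall x, Q x}.
Proof. by move=> PQ; apply: filterS; first exact: (ae_filter_ringOfSetsType mu). Qed.

Lemma ae_and (P Q : R -> Prop) : {ae mu, forall x, P x} ->
  {ae mu, forall x, Q x} -> {ae mu, forall x, P x /\ Q x}.
Proof. by move=> p q; apply: filterI; first exact: (ae_filter_ringOfSetsType mu). Qed.

Lemma ae_neq (c : R) : {ae mu, forall x, (x != c)%R}.
Proof.
exists [set c]; split; [exact: measurable_set1|exact: lebesgue_measure_set1|].
by move=> x /= /negP/negPn/eqP.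
Qed.

(** Serves to identify a convolution through its product with x, which the derivation rule
    computes. *)
Lemma nnX_inj u v : supp 0 u -> supp 0 v -> nnX 0 u = nnX 0 v -> u = v.
Proof.
move=> u0 v0 uv; apply: nnfunP => x; have [x0|x0] := leP x 0%R.
  by rewrite u0// v0.
have : nnX 0 u x = nnX 0 v x by rewrite uv.
rewrite !nnXE ?ltW// subr0 => /(congr1 (fun z => x^-1%:E * z)).
by rewrite !muleA -EFinM mulVf ?gt_eqF// !mul1e.
Qed.

Lemma integral_nnconv u v : \int[mu]_x (u ** v) x = (\int[mu]_x u x) * (\int[mu]_x v x).
Proof.
under eq_integral do rewrite nnconvE.
have m : measurable_fun setT (fun p : R * R => u p.2 * v (p.1 - p.2)%R).
  exact: measurable_conv_integrand.
have p0 (p : R * R) : 0 <= u p.2 * v (p.1 - p.2)%R by rewrite mule_ge0 ?nnf_ge0.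
rewrite (@fubini_tonelli _ _ _ _ R mu mu _ m p0).
rewrite -ge0_integralZr; last 4 first.
- exact: measurableT.
- exact: nnf_measurable.
- by move=> y _; exact: nnf_ge0.
- by apply: integral_ge0 => y _; exact: nnf_ge0.
apply: eq_integral => y _ /=.
rewrite ge0_integralZl//; last 3 first.
- by apply: (measurableT_comp (nnf_measurable v)); exact: measurable_funB.
- by move=> z _; exact: nnf_ge0.
- exact: nnf_ge0.
congr (_ * _); rewrite -[RHS](@ge0_integral_translation _ _ (- y)%R)//.
  exact: nnf_measurable.
exact: nnf_ge0.
Qed.

Lemma ae_eq_nnconv u v w : {ae mu, forall x, v x = w x} -> u ** v = u ** w.
Proof.
move=> vw; rewrite !(nnconvC u); apply: nnfunP => x; rewrite !nnconvE.
apply: ge0_ae_eq_integral => //.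
- exact: measurable_conv_integrand1.
- exact: measurable_conv_integrand1.
- by move=> y _; exact: conv_integrand_ge0.
- by move=> y _; exact: conv_integrand_ge0.
by apply: ae_imp vw => y -> _.
Qed.

(** Lebesgue's differentiation theorem: almost everywhere, u and v are derivatives of the same
    primitive. *)
Lemma ae_eq_nnstep_conv u v : locint v -> nnstep ** u = nnstep ** v ->
  {ae mu, forall x, u x = v x}.
Proof.
move=> lv uv; have lu : locint u by move=> x; rewrite uv.
have fin w : locint w -> {ae mu, forall x, w x \is a fin_num}.
  move=> lw.
  (* An integrable function is almost everywhere finite; [locint] gives integrability on each ]-oo,
     n[, and these half-lines exhaust the line. *)
  have h (n : nat) : {ae mu, forall x, (x < n%:R)%R -> w x \is a fin_num}.
    have /integrable_ae : mu.-integrable `]-oo, n%:R[ w.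
      apply/integrableP; split; first exact: measurable_funTS (nnf_measurable w).
      have := lw n%:R; rewrite nnstep_convE; apply: le_lt_trans.
      rewrite le_eqVlt; apply/orP; left; apply/eqP; apply: eq_integral => y _.
      by rewrite gee0_abs ?nnf_ge0.
    by move=> /(_ (measurable_itv _)); apply: ae_imp => x hx xn; apply: hx;
      rewrite /= in_itv.
  have := (@ae_foralln _ _ _ mu _ h).
  apply: ae_imp => x hx; apply: (hx (Num.truncn x).+1).
  exact: truncnS_gt.
have fu := fin _ lu; have fv := fin _ lv.
have mf w : measurable_fun setT (fun x => fine (w x) : R).
  exact: (measurableT_comp (@fine_measurable _ setT measurableT) (nnf_measurable w)).
have intE w x : locint w -> {ae mu, forall x, w x \is a fin_num} ->
    \int[mu]_(y in `]-oo, x]) (fine (w y))%:E = (nnstep ** w) x.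
  move=> lw fw; rewrite nnstep_convE.
  rewrite -integral_itv_bndo_bndc; last by apply/measurable_EFinP;
    exact: measurable_funTS (mf w).
  apply: ge0_ae_eq_integral => //.
  - by apply/measurable_EFinP; exact: measurable_funTS (mf w).
  - exact: measurable_funTS (nnf_measurable w).
  - by move=> y _; rewrite lee_fin fine_ge0 ?nnf_ge0.
  - by move=> y _; exact: nnf_ge0.
  by apply: ae_imp fw => y yf _; rewrite fineK.
have intw w : locint w -> {ae mu, forall x, w x \is a fin_num} -> forall y,
  mu.-integrable `]-oo, y] (EFin \o (fun x => fine (w x) : R)).
  move=> lw fw y; apply/integrableP; split.
    by apply/measurable_EFinP; exact: measurable_funTS (mf w).
  apply: le_lt_trans (lw y); rewrite -(intE w y lw fw).
  rewrite le_eqVlt; apply/orP; left; apply/eqP; apply: eq_integral => z _.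
  by rewrite gee0_abs// lee_fin fine_ge0 ?nnf_ge0.
have loc w : locint w -> {ae mu, forall x, w x \is a fin_num} -> locally_integrable
  setT (fun x => fine (w x) : R).
  move=> lw fw; split; [exact: mf|exact: openT|move=> K _ cK].
  have [M [_ KM]] := compact_bounded cK.
  have := intw w lw fw (M + 1)%R => /integrableP[_].
  apply: le_lt_trans; apply: ge0_subset_integral => //.
  - exact: compact_measurable.
  - by apply/measurable_EFinP; apply: measurableT_comp => //;
    exact: measurable_funTS (mf w).
  - move=> y Ky /=; rewrite in_itv/=; apply: le_trans (ler_norm _) _.
    by apply: (KM (M + 1)%R) => //; rewrite ltrDl.
have Fu := FTC1Ny (intw u lu fu) (loc u lu fu).
have Fv := FTC1Ny (intw v lv fv) (loc v lv fv).
have FE : (fun x => \int[mu]_(t in `]-oo, x]) (fine (u t)))%R =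
          (fun x => \int[mu]_(t in `]-oo, x]) (fine (v t)))%R.
  by apply/funext => x; rewrite /Rintegral (intE u)// (intE v)// uv.
rewrite /= FE in Fu.
apply: ae_imp (ae_and (ae_and fu fv) (ae_and Fu Fv)) => x [[ux vx] [[_ hu] [_ hv]]].
by rewrite -[LHS]fineK// -[RHS]fineK// -hu -hv.
Qed.

End conv_ae.

(** * The kernel K and the renewal equation *)

Section renewal.
Context {R : realType} (alpha : R).
Hypotheses (alpha_gt0 : 0 < alpha) (alpha_lt1 : alpha < 1).
Local Notation mu := (@lebesgue_measure R).
Local Notation a := (nna alpha).
Local Notation b := (nnb alpha).

Definition dmk (x : R) : R := if (0 < x) && (x < 1) then x `^ (- alpha) - 1 else 0.

Lemma powRN_ge1 (x c : R) : 0 < x <= 1 -> c <= 0 -> 1 <= x `^ c.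
Proof. by move=> x01 c0; rewrite -[leLHS](powRr0 x); exact: ger_powR. Qed.

Lemma powRN_le1 (x c : R) : 1 <= x -> c <= 0 -> x `^ c <= 1.
Proof. by move=> x1 c0; rewrite -[leRHS](powRr0 x); exact: ler_powR. Qed.

Lemma dmk_ge0 x : 0 <= dmk x.
Proof.
rewrite /dmk; case: ifP => // /andP[x0 x1].
by rewrite subr_ge0 powRN_ge1 ?x0 ?ltW// oppr_lt0.
Qed.

Lemma measurable_dmk : measurable_fun setT dmk.
Proof.
apply: measurable_fun_ifT => //.
  by apply: measurable_and; exact: measurable_fun_ltr.
by apply: measurable_funB => //; exact: measurable_powR.
Qed.

Definition nnk := nnreal measurable_dmk dmk_ge0.

(** The excess of H + K over x^{- alpha}: the two agree on ]0, 1], and H + K is 1 beyond. [dmc'] is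
    its derivative. *)
Definition dmc (x : R) : R := if 1 < x then 1 - x `^ (- alpha) else 0.

Lemma dmc_ge0 x : 0 <= dmc x.
Proof.
rewrite /dmc; case: ifP => // x1.
by rewrite subr_ge0 powRN_le1 ?ltW// oppr_lt0.
Qed.

Lemma measurable_dmc : measurable_fun setT dmc.
Proof.
apply: measurable_fun_ifT => //; first exact: measurable_fun_ltr.
by apply: measurable_funB => //; exact: measurable_powR.
Qed.

Definition nnc := nnreal measurable_dmc dmc_ge0.

Definition dmc' (x : R) : R := if 1 < x then alpha * x `^ (- alpha - 1) else 0.

Lemma dmc'_ge0 x : 0 <= dmc' x.
Proof. by rewrite /dmc'; case: ifP => // x1; rewrite mulr_ge0 ?powR_ge0// ltW. Qed.

Lemma measurable_dmc' : measurable_fun setT dmc'.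
Proof.
apply: measurable_fun_ifT => //; first exact: measurable_fun_ltr.
by apply: measurable_funM => //; exact: measurable_powR.
Qed.

Definition nnc' := nnreal measurable_dmc' dmc'_ge0.

Lemma supp_nnk : supp 0 nnk.
Proof. by move=> x x0 /=; rewrite /dmk ltNge x0. Qed.

Lemma supp_nnc' : supp 0 nnc'.
Proof.
by move=> x x0 /=; rewrite /dmc' ltNge (le_trans x0).
Qed.

(** Prepares a * (H + K): the power gives a * x^{- alpha} = H, and c = H * c' with a * c' = beta. *)
Lemma nnstep_nnk : nnadd nnstep nnk = nnadd (nnpow (1 - alpha)) nnc.
Proof.
apply: nnfunP => x /=; rewrite -!EFinD; congr EFin.
rewrite /dmk /dmc /pow_density (_ : 1 - alpha - 1 = - alpha); last ring.
case: (ltgtP 0 x) => x0 /=.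
- case: (ltgtP x 1) => x1 /=; [ring|ring|].
  by rewrite x1 powR1.
- by rewrite ltNge (le_trans (ltW x0)) ?ler01.
- by rewrite -x0 ltNge ler01.
Qed.

Lemma nnstep_nnc' : nnstep ** nnc' = nnc.
Proof.
apply: nnfunP => x; rewrite nnstep_convE /= /dmc.
have [x1|x1] := ltP 1 x; last first.
  rewrite integral0_eq// => y; rewrite /= in_itv/= /dmc' => yx.
  by rewrite ltNge (ltW (lt_le_trans yx x1)).
transitivity (\int[mu]_(y in `]1%R, x]) (alpha%:E * (y `^ (- alpha - 1))%:E))%E.
  rewrite integral_itv_bndo_bndc; last first.
    by apply/measurable_EFinP; exact: measurable_funTS measurable_dmc'.
  rewrite [LHS]integral_mkcond [RHS]integral_mkcond; apply: eq_integral => y _.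
  have mE (i : interval R) : (y \in [set` i]) = (y \in i).
    by apply/idP/idP => [/set_mem//|h]; exact: mem_set.
  rewrite !patchE !mE !in_itv/= /dmc'; case: (leP y x) => //= yx.
    by rewrite andbT; case: ifP => //; rewrite EFinM.
  by rewrite andbF.
have mp : measurable_fun `[1, x] (fun y : R => (y `^ (- alpha - 1))%:E).
  by apply/measurable_EFinP; apply: measurable_funTS; exact: measurable_powR.
rewrite integral_itv_obnd_cbnd; last first.
  apply: emeasurable_funM => //; apply: measurable_funS mp => //.
  by move=> y /=; rewrite !in_itv/= => /andP[/ltW -> ->].
rewrite ge0_integralZl//; last 2 first.
- by move=> y _; rewrite lee_fin powR_ge0.
- by rewrite lee_fin ltW.
rewrite integral_powR_itv ?oppr_eq0 ?gt_eqF// -EFinM powR1; congr EFin; field.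
by rewrite gt_eqF.
Qed.

Lemma nnX_nnc' : nnadd (nnscale alpha nnc) (nnX 0 nnc') = nnscale alpha (nnshift 1
  nnstep).
Proof.
apply: nnfunP => x; have [x1|x1] := leP x 1.
  rewrite /= /dmc /dmc' subr_gt0 ltNge x1/= !mule0 adde0//.
have x0 : 0 < x by exact: lt_trans x1.
rewrite [LHS]/= -[X in (_ + X)%E]/(nnX 0 nnc' x) nnXE ?ltW//.
rewrite /= /dmc /dmc' subr_gt0 x1 ger0_norm ?ltW// -!EFinM -EFinD; congr EFin.
have -> : (x - 0) * (alpha * x `^ (- alpha - 1)) = alpha * x `^ (- alpha).
  rewrite subr0 mulrCA; congr (_ * _).
  rewrite -[X in X * _ = _]powRr1 ?ltW// -powRD; last by rewrite (gt_eqF x0) implybT.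
  by congr (_ `^ _); ring.
ring.
Qed.

(** The convolution is identified without evaluating it: x (a * c') = a * (alpha c + x c') = alpha a
    * tau_1 H, since alpha c + x c' is the constant alpha beyond 1, and this is x beta. *)
Lemma a_conv_c' : a ** nnc' = b.
Proof.
apply: nnX_inj.
- by rewrite -(addr0 0); apply: supp_conv; [exact: supp_nna|exact: supp_nnc'].
- exact: supp0_nnb.
have := nnX_conv (@supp_nna _ alpha) supp_nnc'; rewrite addr0 => ->.
rewrite nnX_nnb// nnX_nna// nnconvZl (nnconvC nnstep) -nnconvA nnstep_nnc'.
rewrite -nnconvZr -nnconvDr nnX_nnc' nnconvZr.
by rewrite nnconv_shiftr nnconv_shiftr nnconvC.
Qed.

(* Up to the constant [dm_C0], this is [a] convolved with [x^{- alpha}]: it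
   satisfies [x B = H * B], hence is constant on ]0, +oo[, and integrating it
   against [exp (- x)] identifies the constant as
   [gamma_fun alpha * gamma_fun (1 - alpha)]. *)
Definition beta_pow := nnpow alpha ** nnpow (1 - alpha).

Let alpha1_gt0 : 0 < 1 - alpha. Proof. by rewrite subr_gt0. Qed.

Lemma supp_beta_pow : supp 0 beta_pow.
Proof. by rewrite -(addr0 0); apply: supp_conv; exact: supp_nnpow. Qed.

Lemma locint_beta_pow : locint beta_pow.
Proof.
by apply: locint_conv; [exact: supp_nnpow|exact: supp_nnpow|exact: locint_nnpow|
  exact: locint_nnpow].
Qed.

(** The factors alpha and 1 - alpha contributed by the two powers add up to 1. *)
Lemma nnX_beta_pow : nnX 0 beta_pow = nnstep ** beta_pow.
Proof.
have := nnX_conv (@supp_nnpow R alpha) (@supp_nnpow R (1 - alpha)); rewrite addr0 => ->.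
rewrite !nnX_nnpow// nnconvZl nnconvZr -nnconvA nnconvCA.
rewrite -nnscaleDl ?ltW//.
have -> : alpha + (1 - alpha) = 1 by ring.
by apply: nnfunP => x; rewrite nnscaleE// mul1e.
Qed.

Lemma beta_pow_fin x : (beta_pow x < +oo)%E.
Proof. exact: (fin_of_primitive supp_beta_pow locint_beta_pow nnX_beta_pow). Qed.

Lemma mulX_beta_pow (x : R) : x * fine (beta_pow x) = primitive beta_pow x.
Proof.
rewrite /primitive -nnX_beta_pow; have [x0|x0] := leP x 0.
  have -> : nnX 0 beta_pow x = ((Num.max (x - 0) 0)%:E * beta_pow x)%E by [].
  by rewrite supp_beta_pow// mulr0 mule0.
rewrite nnXE ?ltW// subr0 -[beta_pow x in RHS]fineK -?EFinM//.
by rewrite ge0_fin_numE ?nnf_ge0 ?beta_pow_fin.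
Qed.

Lemma beta_pow_cst : exists2 c : R, 1 <= c & beta_pow = nnscale c nnstep.
Proof.
pose f x := fine (beta_pow x).
pose P := primitive beta_pow.
have cP := primitive_continuous supp_beta_pow locint_beta_pow beta_pow_fin.
have fP (x : R) : 0 < x -> f x = x^-1 * P x.
  by move=> x0; rewrite /f /P -mulX_beta_pow mulrA mulVf ?mul1r// gt_eqF.
have near_pos (x : R) : 0 < x -> \forall z \near x, 0 < z.
  by move=> x0; exact: lt_nbhsr.
have cf (x : R) : 0 < x -> {for x, continuous f}.
  move=> x0.
  have h : z^-1 * P z @[z --> x] --> f x.
    rewrite fP//; apply: cvgM; last exact: cP.
    by apply: cvgV; [rewrite gt_eqF|exact: cvg_id].
  apply: cvg_trans h; apply: near_eq_cvg.
  by apply: filterS (near_pos x x0) => z z0; rewrite fP.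
(* With P the primitive of f and f = P / x, the derivative of P / x is f / x - P / x^2 = 0. *)
have df (x : R) : 0 < x -> is_derive x 1 (fun z => z^-1 * P z) 0.
  move=> x0.
  have dP := primitive_derive supp_beta_pow locint_beta_pow beta_pow_fin (cf x x0).
  have xn0 : x != 0 by rewrite gt_eqF.
  have dV : is_derive x 1 (fun z : R => z^-1) (- x ^- 2 *: 1).
    exact: (is_deriveV xn0).
  have := is_deriveM dV dP => /is_derive_eq; apply.
  rewrite -/P /GRing.scale/= -/(f x) fP//; field.
  exact: xn0.
have constf (x : R) : 0 < x -> f x = f 1.
  move=> x0.
  have h (u v : R) : 0 < u -> u < v -> f u = f v.
    move=> u0 uv.
    have [||c _] := @MVT _ (fun z => z^-1 * P z) (fun=> 0) u v uv.
    - by move=> z; rewrite in_itv/= => /andP[uz _]; apply: df; exact: lt_trans uz.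
    - apply: continuous_in_subspaceT => z; rewrite inE/= in_itv/= => /andP[uz _].
      have z0 : 0 < z by exact: lt_le_trans uz.
      have [d _] := df z z0; apply: differentiable_continuous.
      exact/derivable1_diffP.
    rewrite mul0r => /eqP; rewrite subr_eq0 => /eqP.
    by rewrite !fP// (lt_trans u0 uv).
  by case: (ltgtP x 1) => [x1|x1|->//]; [exact: h|rewrite (h 1 x)].
exists (f 1).
  (* At x = 1 the integrand y^{alpha - 1} (1 - y)^{- alpha} is at least 1 on ]0, 1[. The bound
     excludes c = 0, so that c can be inverted. *)
  rewrite -lee_fin /f fineK ?ge0_fin_numE ?nnf_ge0 ?beta_pow_fin//.
  rewrite /beta_pow nnconvE.
  have -> : (1%:E = \int[mu]_(y in `]0%R, 1%R[) (cst 1%:E y) :> \bar R)%E.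
    by rewrite integral_cst//= mul1e lebesgue_measure_itv/= lte01 sube0.
  rewrite integral_mkcond; apply: ge0_le_integral => //.
  - by move=> y _; rewrite patchE; case: ifP.
  - exact/(measurable_restrictT _ _).1.
  - exact: measurable_conv_integrand1.
  move=> y _; rewrite patchE; case: ifPn => [|_]; last exact: conv_integrand_ge0.
  rewrite inE/= in_itv/= /pow_density subr_gt0 => /andP[y0 y1].
  rewrite y0 y1 -EFinM lee_fin -[leLHS]mulr1; apply: ler_pM => //.
    by apply: powRN_ge1; rewrite ?y0 ?ltW// subr_lt0.
  by apply: powRN_ge1; [rewrite subr_gt0 y1 gerBl ltW|rewrite addrAC subrr add0r
    oppr_le0 ltW].
apply: nnfunP => x; rewrite nnscaleE; last by rewrite /f fine_ge0 ?nnf_ge0.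
have [x0|x0] := leP x 0.
  by rewrite supp_beta_pow// supp_step// mule0.
rewrite /= x0 mule1 -(constf x)// /f fineK// ge0_fin_numE ?nnf_ge0 ?beta_pow_fin//.
Qed.

(** The weight e^{-x} is multiplicative for convolution, and it makes total integrals finite: this
    is the Laplace transform at 1. *)
Definition nnexp u := nnmul (nnreal (@measurableT_comp _ _ _ _ _ _ _ _ _
  (@measurable_expR R) (@oppr_measurable R setT)) (fun x => expR_ge0 (- x))) u.

Lemma nnexpE u x : nnexp u x = ((expR (- x))%:E * u x)%E. Proof. by []. Qed.

Lemma nnexp_conv u v : nnexp (u ** v) = nnexp u ** nnexp v.
Proof.
apply: nnfunP => x; rewrite nnexpE !nnconvE -ge0_integralZl; last 4 first.
- exact: measurableT.
- exact: measurable_conv_integrand1.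
- by move=> y _; exact: conv_integrand_ge0.
- by rewrite lee_fin expR_ge0.
apply: eq_integral => y _; rewrite !nnexpE muleACA -EFinM -expRD.
by congr ((expR _)%:E * _)%E; ring.
Qed.

Lemma integral_nnexp_nnstep : (\int[mu]_x nnexp nnstep x = 1)%E.
Proof.
rewrite -(integral_exponential_pdf (@ltr01 R)).
apply: ge0_ae_eq_integral => //.
- exact: nnf_measurable.
- by apply/measurable_EFinP; exact: measurable_exponential_pdf.
- by move=> x _; exact: nnf_ge0.
- by move=> x _; rewrite lee_fin exponential_pdf_ge0.
apply: ae_imp (ae_neq 0) => x x0 _; rewrite nnexpE /=.
case: (ltgtP 0 x) x0 => x0 //= _.
- by rewrite exponential_pdfE ?ltW// mule1 mul1r mulN1r.
- by rewrite mule0 lt0_exponential_pdf.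
Qed.

(** Gamma as an extended number: [gamma_fun] reads 0 on a divergent integral, so convergence has to
    be tracked separately. *)
Definition gamma_ext (s : R) : \bar R := (\int[mu]_x nnexp (nnpow s) x)%E.

Lemma gamma_extE s : gamma_fun s = fine (gamma_ext s).
Proof.
rewrite /gamma_fun /Rintegral; congr fine; rewrite integral_mkcond.
apply: eq_integral => x _; rewrite patchE nnexpE /= /pow_density.
have -> : (x \in `]0, +oo[%classic) = (0 < x).
  by apply/idP/idP => [/set_mem|h]; [|apply: mem_set]; rewrite /= in_itv/= andbT.
by case: ifP => _; rewrite -EFinM ?mulr0// mulrC.
Qed.

Lemma gamma_ext_ge0 s : (0 <= gamma_ext s)%E.
Proof. by apply: integral_ge0 => x _; exact: nnf_ge0. Qed.

Lemma nnexp_scale c u : nnexp (nnscale c u) = nnscale c (nnexp u).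
Proof. by apply: nnfunP => x; rewrite /= muleCA. Qed.

Lemma a_conv_nnpow : a ** nnpow (1 - alpha) = nnstep.
Proof.
have [c c1 cE] := beta_pow_cst; have c0 : 0 < c by exact: lt_le_trans c1.
have gE : (gamma_ext alpha * gamma_ext (1 - alpha) = c%:E)%E.
  rewrite /gamma_ext -integral_nnconv -nnexp_conv -/beta_pow cE nnexp_scale.
  under eq_integral do rewrite nnscaleE ?ltW//.
  rewrite ge0_integralZl//; last 3 first.
  - exact: nnf_measurable.
  - by move=> x _; exact: nnf_ge0.
  - by rewrite lee_fin ltW.
  by rewrite integral_nnexp_nnstep mule1.
(* The product of the two Gamma integrals is finite and nonzero, which forces both factors to be
   finite; only then does [gamma_fun] give their true values. *)
have C0E : dm_C0 alpha = c^-1.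
  rewrite /dm_C0 !gamma_extE div1r; congr (_^-1).
  move: gE (gamma_ext_ge0 alpha) (gamma_ext_ge0 (1 - alpha)).
  case: (gamma_ext alpha) => [r| |] //; case: (gamma_ext (1 - alpha)) => [t| |] //=.
  - by rewrite -EFinM => -[<-] _ _; rewrite mulrC.
  - move=> + r0 _; have [->|rn] := eqVneq r 0; first by rewrite mul0e => -[/eqP];
    rewrite lt_eqF.
    by rewrite gt0_muley// lte_fin lt_def rn -lee_fin.
  - move=> + _ t0; have [->|tn] := eqVneq t 0; first by rewrite mule0 => -[/eqP];
    rewrite lt_eqF.
    by rewrite muleC gt0_muley// lte_fin lt_def tn -lee_fin.
rewrite /nna nnconvZl -/beta_pow cE nnscaleA C0E mulVf ?gt_eqF//.
by apply: nnfunP => x; rewrite nnscaleE// mul1e.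
Qed.

Lemma a_conv_step_k : a ** nnadd nnstep nnk = nnadd nnstep (nnstep ** b).
Proof.
by rewrite nnstep_nnk nnconvDr a_conv_nnpow -nnstep_nnc' nnconvCA a_conv_c'.
Qed.

Variable g : nnfun R.
Hypothesis g_renewal :
  {ae mu, forall x, (nnadd nnstep nnk ** g) x = nnstep x}.

(** Convolving with a turns the almost everywhere hypothesis into H * (g + beta * g) = H * a at
    every point; differentiating removes H. *)
Lemma renewal_ae : {ae mu, forall x, (g x + (b ** g) x = a x)%E}.
Proof.
apply: (@ae_eq_nnstep_conv _ (nnadd g (b ** g)) a); first exact: locint_nna.
rewrite nnconvDr nnconvA -nnconvDl -a_conv_step_k -nnconvA (ae_eq_nnconv a g_renewal).
exact: nnconvC.
Qed.

Definition remainder n := iter n (nnconv b) g.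

(** One convolution with beta erases the exceptional null set of [renewal_ae]: the identity holds at
    every x, but only from rank 1 on. *)
Lemma remainder_step n x : (remainder n.+1 x + remainder n.+2 x = nnG alpha 0 n.+1 x)%E.
Proof.
have h : forall m, iter m (nnconv b) (b ** nnadd g (b ** g)) = iter m (nnconv b) (b ** a).
  by move=> m; rewrite (@ae_eq_nnconv _ b (nnadd g (b ** g)) a renewal_ae).
have e : forall m u v, iter m (nnconv b) (nnadd u v) = nnadd (iter m (nnconv b) u)
  (iter m (nnconv b) v).
  by elim=> //= m ih u v; rewrite ih nnconvDr.
have := h n; rewrite nnconvDr e -!iterSr.
by move/(congr1 (fun u : nnfun R => u x)).
Qed.

Hypothesis g_supp : supp 0 g.
Hypothesis g_fin : forall x, (g x < +oo)%E.

Lemma supp_remainder n : supp n%:R (remainder n).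
Proof.
elim: n => // n ih.
rewrite (_ : n.+1%:R = 1 + n%:R); last by rewrite -[LHS]natr1 addrC.
exact: supp_conv (@supp_nnb _ alpha) ih.
Qed.

Lemma remainder_fin n x : (remainder n x < +oo)%E.
Proof.
case: n => [|n]; first exact: g_fin.
apply: le_lt_trans (nnG_fin alpha_gt0 0 n.+1 x).
by rewrite -remainder_step leeDl// nnf_ge0.
Qed.

(** A single null set, the one of [renewal_ae], works for all n; this allows n to be chosen
    depending on x. *)
Lemma renewal_expansion : {ae mu, forall x, forall n,
  fine (g x) = \sum_(j < n) dm_g alpha j x + (-1) ^+ n * fine (remainder n x)}.
Proof.
apply: ae_imp renewal_ae => x h0; elim=> [|n ih].
  by rewrite big_ord0 add0r mul1r.
rewrite big_ord_recr/= ih dm_gE// -addrA; congr (_ + _).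
have -> : Gr alpha 0 n x = fine (remainder n x) + fine (remainder n.+1 x).
  rewrite -fineD ?ge0_fin_numE ?nnf_ge0 ?remainder_fin// /Gr.
  by case: n {ih} => [|n]; [rewrite -h0|rewrite -remainder_step].
by rewrite exprS; ring.
Qed.

End renewal.

Section density_representative.
Context {R : realType} (alpha : R).
Hypotheses (alpha_gt0 : 0 < alpha) (alpha_lt1 : alpha < 1).

(** The sum of the whole series of the g_j: since g_j vanishes on ]-oo, j], the terms left out are 0
    at x. *)
Definition dm_density (x : R) : R := \sum_(j < (Num.truncn x).+1) dm_g alpha j x.

Lemma supp_dm_g j x : x <= j%:R -> dm_g alpha j x = 0.
Proof.
suff h : supp j%:R (nnG alpha 0 j) by move=> xj; rewrite dm_gE// /Gr h ?mulr0.
elim: j => [|j ih]; first exact: supp_nna.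
rewrite (_ : j.+1%:R = 1 + j%:R); last by rewrite -[LHS]natr1 addrC.
exact: supp_conv (@supp_nnb _ alpha) ih.
Qed.

Lemma sum_dm_g_extend n k x : (n <= k)%N -> x <= n%:R ->
  \sum_(j < k) dm_g alpha j x = \sum_(j < n) dm_g alpha j x.
Proof.
move=> nk xn; rewrite -!(big_mkord xpredT (fun j => dm_g alpha j x)).
rewrite (big_cat_nat _ nk)//= [X in _ + X]big_nat_cond [X in _ + X]big1 ?addr0//.
move=> j /andP[/andP[nj _] _]; apply: supp_dm_g.
by rewrite (le_trans xn)// ler_nat.
Qed.

Lemma dm_densityE k x : x <= k%:R -> dm_density x = \sum_(j < k) dm_g alpha j x.
Proof.
move=> xk; rewrite /dm_density.
have xt := ltW (truncnS_gt x).
by have [h|/ltnW h] := leqP (Num.truncn x).+1 k;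
  [rewrite (sum_dm_g_extend h)|rewrite (sum_dm_g_extend h)].
Qed.

(** An open set on which [dm_density] is one fixed sum of k terms, so that the operators can be
    applied to it termwise. *)
Definition nonint_below (k : nat) : set R := nonint `&` `]-oo, k%:R[.

Lemma nonint_below_open k : open (nonint_below k).
Proof. by apply: openI; [exact: nonint_open|exact: interval_open]. Qed.

Lemma dm_density_continuous x : nonint x -> {for x, continuous dm_density}.
Proof.
move=> nx; pose k := (Num.truncn x).+1.
have xk : nonint_below k x by split => //=; rewrite in_itv/= truncnS_gt.
have c : (\sum_(j < k) dm_g alpha j z) @[z --> x] --> \sum_(j < k) dm_g alpha j x.
  apply: cvg_big => [|j _]; first exact: add_continuous.
  have -> : dm_g alpha j = (fun z => (-1) ^+ j * Gr alpha 0 j z).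
    by apply/funext => z; rewrite dm_gE.
  apply: cvgM; first exact: cvg_cst.
  apply: Gr_continuous => //; exact: (@nonint_neq _ _ 0).
rewrite -(@dm_densityE k) in c; last by case: xk => _ /=; rewrite in_itv/= => /ltW.
apply: cvg_trans c; apply: near_eq_cvg.
have nU : nbhs x (nonint_below k) by exact: open_nbhs_nbhs (conj (@nonint_below_open k)
  xk).
by apply: filterS nU => z [_ /=]; rewrite in_itv/= => /ltW/dm_densityE ->.
Qed.

Lemma dm_density_annihilated k x : x <= k%:R -> nonint x ->
  opE_annihilates_at alpha k dm_density x.
Proof.
move=> xk nx.
apply: (@opE_chain_annihilates _ alpha k _ (fun j z => \sum_(n < k) dmF alpha n j z)
  (nonint_below k)).
- exact: nonint_below_open.
- move=> z [_ /=]; rewrite in_itv/= => /ltW/dm_densityE ->.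
  by apply: eq_bigr => j _; rewrite dmF0.
- move=> j z jk [nz _].
  have h (n : 'I_k) : is_derive z 1 (fun z => (z - j%:R) * dmF alpha n j z)
    (dmF alpha n j.+1 z + j.+1%:R * alpha * dmF alpha n j z) by exact: dmF_derive.
  have := is_derive_sum h.
  have -> : \sum_(n < k) (fun z => (z - j%:R) * dmF alpha n j z) =
      (fun z => (z - j%:R) * \sum_(n < k) dmF alpha n j z).
    by apply/funext => y; rewrite fct_sumE mulr_sumr.
  by move=> /is_derive_eq; apply; rewrite big_split/= mulr_sumr.
- by move=> z _; rewrite big1// => n _; exact: dmF_last.
- by split => //=; rewrite in_itv/= lt_neqAle xk andbT; exact: nonint_neq.
Qed.

Lemma dm_density_ae (g : nnfun R) : supp 0 g -> (forall x, (g x < +oo)%E) ->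
  {ae @lebesgue_measure R, forall x, (nnadd nnstep (nnk alpha_gt0) ** g) x = nnstep x} ->
  {ae @lebesgue_measure R, forall x, dm_density x = fine (g x)}.
Proof.
move=> g0 gfin gr; have := renewal_expansion alpha_lt1 gr gfin.
apply: ae_imp => x /(_ (Num.truncn x).+1) ->.
rewrite supp_remainder ?mulr0 ?addr0//.
exact/ltW/truncnS_gt.
Qed.

End density_representative.

(** * Fourier uniqueness *)

Section fubini_kernel.
Context {R : realType}.
Local Notation mu := (@lebesgue_measure R).

Lemma integrable_bounded_mul (g k : R -> R) : mu.-integrable setT (EFin \o g) ->
  measurable_fun setT k -> (forall y, `|k y| <= 1) ->
  mu.-integrable setT (EFin \o (fun y => g y * k y)).
Proof.
move=> ig mk k1; have /integrableP[/measurable_EFinP mg _] := ig.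
apply: le_integrable ig => //.
  by apply/measurable_EFinP; exact: measurable_funM.
move=> y _; rewrite /= lee_fin normrM -[leRHS]mulr1.
by rewrite ler_wpM2l.
Qed.

(** Used twice: to average cosines over an exponential frequency, and to average Cauchy kernels over
    their centre. *)
Lemma fubini_kernel (f g : R -> R) (k : R * R -> R) :
  mu.-integrable setT (EFin \o f) -> mu.-integrable setT (EFin \o g) ->
  measurable_fun setT k -> (forall p, `|k p| <= 1) ->
  \int[mu]_x (f x * \int[mu]_y (g y * k (x, y))) =
  \int[mu]_y (g y * \int[mu]_x (f x * k (x, y))).
Proof.
move=> intf intg mk k1.
have /integrableP[/measurable_EFinP mf fi] := intf.
have /integrableP[/measurable_EFinP mg gi] := intg.
pose F (p : R * R) := (f p.1 * (g p.2 * k p))%:E.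
have mF : measurable_fun setT F.
  apply/measurable_EFinP; apply: measurable_funM; first exact: measurableT_comp mf _.
  by apply: measurable_funM => //; exact: measurableT_comp mg _.
have intF : (mu \x mu)%E.-integrable setT F.
  have [_ h12] := @integrable12ltyP _ _ _ _ R mu mu F mF; apply: h12.
  apply: (@le_lt_trans _ _ (\int[mu]_x (`|(f x)%:E| * \int[mu]_y `|(g y)%:E|))%E);
    last first.
    rewrite ge0_integralZr//; last 2 first.
    - by apply: measurableT_comp => //; exact/measurable_EFinP.
    - by apply: integral_ge0.
    by rewrite lte_mul_pinfty// ?integral_ge0// ge0_fin_numE ?integral_ge0.
  apply: ge0_le_integral => //.
  - by move=> x _; exact: integral_ge0.
  - apply: (@measurable_fun_fubini_tonelli_F _ _ _ _ R mu (abse \o F)).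
      exact: measurableT_comp.
    by move=> p; exact: abse_ge0.
  - apply: emeasurable_funM => //.
    by apply: measurableT_comp => //; exact/measurable_EFinP.
  move=> x _; rewrite -ge0_integralZl//; last first.
    by apply: measurableT_comp => //; exact/measurable_EFinP.
  apply: ge0_le_integral => //.
  - apply: measurableT_comp => //; apply/measurable_EFinP.
    apply: (measurable_funM (measurable_cst (f x))); apply: (measurable_funM mg).
    exact: measurableT_comp mk _.
  - by apply: emeasurable_funM => //; apply: measurableT_comp => //;
    exact/measurable_EFinP.
  move=> y _; rewrite /F/= lee_fin !normrM ler_wpM2l// -[leRHS]mulr1.
  by rewrite ler_wpM2l.
have e1 x : (\int[mu]_y F (x, y) = (f x * \int[mu]_y (g y * k (x, y)))%:E)%E.
  have h : mu.-integrable setT (EFin \o (fun y => g y * k (x, y))).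
    apply: integrable_bounded_mul => //; exact: measurableT_comp mk _.
  rewrite /F/= -RintegralZl//; apply/esym; rewrite /Rintegral fineK//.
  exact: (integrable_fin_num measurableT (integrableZl measurableT (f x) h)).
have e2 y : (\int[mu]_x F (x, y) = (g y * \int[mu]_x (f x * k (x, y)))%:E)%E.
  have h : mu.-integrable setT (EFin \o (fun x => f x * k (x, y))).
    apply: integrable_bounded_mul => //; exact: measurableT_comp mk _.
  have -> : (\int[mu]_x F (x, y) = \int[mu]_x ((g y)%:E * (f x * k (x, y))%:E))%E.
    by apply: eq_integral => x _; rewrite /F/= -EFinM mulrCA.
  rewrite (integralZl measurableT h) EFinM /Rintegral fineK//.
  exact: integrable_fin_num h.
rewrite /Rintegral; congr fine.
under eq_integral do rewrite -e1.
rewrite (@Fubini _ _ _ _ R mu mu F intF).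
by apply: eq_integral => y _; rewrite e2.
Qed.

End fubini_kernel.

(* Averaging [cos (s v)] over an exponentially distributed [s] produces the
   Cauchy kernel in [v], so that a function with vanishing transforms is
   orthogonal to all Cauchy kernels; their primitives are arctangents, which
   tend to indicators of intervals as [r] tends to 0. *)
Section poisson.
Context {R : realType}.
Local Notation mu := (@lebesgue_measure R).
Variable r : R.
Hypothesis r0 : 0 < r.

(** A primitive in s of r e^{- r s} (1 + cos (s v)). The added 1 keeps the integrand nonnegative, as
    the fundamental theorem on [0, +oo[ requires; its contribution, the exponential mass 1, is
    removed in [integral_poisson_kernel]. *)
Definition poisson_prim (v s : R) : R :=
  - expR (- r * s) + r * (expR (- r * s) * (v * sin (s * v) - r * cos (s * v))) / (r ^+
    2 + v ^+ 2).

Lemma den_neq0 v : r ^+ 2 + v ^+ 2 != 0.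
Proof. by rewrite gt_eqF// ltr_pwDl ?exprn_gt0// sqr_ge0. Qed.

Lemma is_derive_poisson_prim (v s : R) : is_derive s 1 (poisson_prim v)
  (r * expR (- r * s) * (1 + cos (s * v))).
Proof.
have he : is_derive s 1 (fun s => expR (- r * s)) (- r * expR (- r * s)).
  by apply: is_derive_eq; rewrite /GRing.scale/=; ring.
have hs : is_derive s 1 (fun s => sin (s * v)) (v * cos (s * v)).
  by apply: is_derive_eq; rewrite /GRing.scale/=; ring.
have hc : is_derive s 1 (fun s => cos (s * v)) (- (v * sin (s * v))).
  by apply: is_derive_eq; rewrite /GRing.scale/=; ring.
rewrite /poisson_prim; apply: is_derive_eq.
rewrite /GRing.scale/=; field; exact: den_neq0.
Qed.

Lemma poisson_prim_cvg (v : R) : poisson_prim v s @[s --> +oo] --> 0.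
Proof.
have ce : expR (- r * s) @[s --> +oo] --> 0.
  rewrite (_ : (fun s => expR (- r * s)) = (fun z => expR (- z)) \o (fun z => r * z));
    last first.
    by apply/funext => z; rewrite /= mulNr.
  apply: (@cvg_comp _ _ _ _ _ _ (pinfty_nbhs R)); last exact: cvgr_expR.
  exact: gt0_cvgMry.
pose M := 1 + r * (`|v| + r) / (r ^+ 2 + v ^+ 2).
have d0 : 0 < r ^+ 2 + v ^+ 2 by rewrite ltr_pwDl ?exprn_gt0// sqr_ge0.
have bnd s : `|poisson_prim v s| <= M * expR (- r * s).
  rewrite /poisson_prim mulrDl mul1r.
  apply: (le_trans (ler_normD _ _)); rewrite normrN (ger0_norm (expR_ge0 _)) lerD2l.
  have d1 : 0 <= (r ^+ 2 + v ^+ 2)^-1 by rewrite invr_ge0 ltW.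
  rewrite normrM (ger0_norm d1) [leRHS]mulrAC ler_wpM2r//.
  rewrite !normrM (gtr0_norm r0) (ger0_norm (expR_ge0 _)) -mulrA ler_pM2l// mulrC.
  rewrite ler_wpM2r ?expR_ge0//; apply: (le_trans (ler_normB _ _)).
  rewrite !normrM (gtr0_norm r0) lerD//.
    by rewrite ler_piMr// sin_max.
  by rewrite ler_piMr ?(ltW r0)// cos_max.
have cM : M * expR (- r * s) @[s --> +oo] --> 0.
  by rewrite -(mulr0 M); apply: cvgM; [exact: cvg_cst|exact: ce].
apply: (@squeeze_cvgr _ _ _ _ (fun s => - (M * expR (- r * s))) (fun s => M * expR (- r
  * s))).
- by apply: nearW => s; rewrite -ler_norml.
- by rewrite -oppr0; exact: cvgN.
- exact: cM.
Qed.

Lemma measurable_cosM (v : R) : measurable_fun setT (fun s : R => cos (s * v)).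
Proof.
apply: continuous_measurable_fun => s; apply: continuous_comp; last exact: continuous_cos.
by apply: cvgM; [exact: cvg_id|exact: cvg_cst].
Qed.

Lemma integral_poisson_kernel (v : R) :
  \int[mu]_s (exponential_pdf r s * cos (s * v)) = (1 + (v / r) ^+ 2)^-1.
Proof.
have dP := is_derive_poisson_prim v.
have cP : continuous (poisson_prim v).
  by move=> s; have [d _] := dP s; apply: differentiable_continuous;
    exact/derivable1_diffP.
have cf : continuous (fun s => r * expR (- r * s) * (1 + cos (s * v))).
  move=> s; apply: cvgM; [apply: cvgM; first exact: cvg_cst|apply: cvgD;
    first exact: cvg_cst].
    apply: continuous_comp; last exact: continuous_expR.
    by apply: cvgM; [exact: cvg_cst|exact: cvg_id].
  apply: continuous_comp; last exact: continuous_cos.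
  by apply: cvgM; [exact: cvg_id|exact: cvg_cst].
have I1 : (\int[mu]_(s in `[0%R, +oo[) (r * expR (- r * s) * (1 + cos (s * v)))%:E =
  0%:E - (poisson_prim v 0)%:E)%E.
  apply: ge0_continuous_FTC2y.
  - move=> s _; apply: mulr_ge0; first by rewrite mulr_ge0 ?expR_ge0 ?(ltW r0).
    by have := cos_geN1 (s * v); lra.
  - exact: continuous_subspaceT.
  - exact: poisson_prim_cvg.
  - by move=> s _; have [] := dP s.
  - exact/cvg_at_right_filter/cP.
  - by move=> s _; rewrite derive1E; have [_ ->] := dP s.
have ie := integrable_exponential_pdf r0.
have ic := integrable_bounded_mul ie (measurable_cosM v) (fun s => cos_max (s * v)).
have e1 : \int[mu]_s (exponential_pdf r s + exponential_pdf r s * cos (s * v)) =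
    - poisson_prim v 0.
  rewrite /Rintegral -[RHS]/(fine (- poisson_prim v 0)%:E) EFinN -sub0e -I1.
  rewrite [in RHS]integral_mkcond; congr fine; apply: eq_integral => s _.
  rewrite patchE; have -> : (s \in `[0, +oo[%classic) = (0 <= s).
    by apply/idP/idP => [/set_mem|h]; [|apply: mem_set]; rewrite /= in_itv/= andbT.
  have [s0|s0] := leP 0 s; first by rewrite exponential_pdfE//; congr EFin; ring.
  by rewrite lt0_exponential_pdf// mul0r addr0.
rewrite RintegralD// in e1.
have e2 : \int[mu]_s exponential_pdf r s = 1.
  by rewrite /Rintegral integral_exponential_pdf.
move: e1; rewrite e2 /poisson_prim mulr0 expR0 mul0r sin0 cos0 => h.
have -> : \int[mu]_s (exponential_pdf r s * cos (s * v)) =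
  - 1 - (- 1 + r * (1 * (v * 0 - r * 1)) / (r ^+ 2 + v ^+ 2)) by rewrite -[LHS](addKr
    1) h; ring.
have rn : r != 0 by rewrite gt_eqF.
by field; rewrite rn den_neq0.
Qed.

Definition cauchy_kernel (v : R) := (1 + (v / r) ^+ 2)^-1.

Lemma cauchy_kernel_norm v : `|cauchy_kernel v| <= 1.
Proof.
have h : 1 <= 1 + (v / r) ^+ 2 by rewrite lerDl sqr_ge0.
rewrite ger0_norm; last by rewrite invr_ge0 (le_trans _ h).
by rewrite invf_le1// (lt_le_trans _ h).
Qed.

Lemma continuous_cauchy_kernel : continuous cauchy_kernel.
Proof.
move=> v; apply: cvgV.
  by rewrite gt_eqF// ltr_pwDl// sqr_ge0.
apply: cvgD; first exact: cvg_cst.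
by apply: cvgM; (apply: cvgM; [exact: cvg_id|exact: cvg_cst]).
Qed.

Lemma integral_cauchy_kernel (A B x : R) : A < B ->
  \int[mu]_y (\1_(`[A, B]) y * cauchy_kernel (x - y)) =
  r * (atan ((B - x) / r) - atan ((A - x) / r)).
Proof.
move=> AB.
have dA (y : R) : is_derive y 1 (fun y => r * atan ((y - x) / r)) (cauchy_kernel (x - y)).
  have h : is_derive y 1 (fun y => (y - x) / r) r^-1.
    by apply: is_derive_eq; rewrite /GRing.scale/=; ring.
  have h2 := @is_derive1_comp _ atan (fun y => (y - x) / r) y _ _ (is_derive1_atan _) h.
  have := is_deriveZ r h2 => /is_derive_eq; apply.
  rewrite /GRing.scale/= mulrCA mulfV ?gt_eqF// mulr1 /cauchy_kernel.
  by rewrite -(opprB y x) mulNr sqrrN.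
have cA : continuous (fun y => r * atan ((y - x) / r)).
  by move=> y; have [d _] := dA y; apply: differentiable_continuous;
    exact/derivable1_diffP.
rewrite /Rintegral; transitivity (fine (\int[mu]_(y in `[A, B]) (cauchy_kernel (x -
  y))%:E)).
  congr fine; rewrite [RHS]integral_mkcond; apply: eq_integral => y _.
  by rewrite patchE indicE; case: ifP => _; rewrite ?mul1r ?mul0r.
rewrite (@continuous_FTC2 _ (fun y => cauchy_kernel (x - y)) (fun y => r * atan ((y -
  x) / r)))//.
- by rewrite -EFinB /= mulrBr.
- apply: continuous_subspaceT => y.
  apply: (@continuous_comp _ _ _ (fun y => x - y) cauchy_kernel);
    last exact: continuous_cauchy_kernel.
  by apply: cvgB; [exact: cvg_cst|exact: cvg_id].
- split; [by move=> y _; have [] := dA y|exact/cvg_at_right_filter/cA|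
  exact/cvg_at_left_filter/cA].
- by move=> y _; rewrite derive1E; have [_ ->] := dA y.
Qed.

End poisson.

Section fourier_uniqueness.
Context {R : realType}.
Local Notation mu := (@lebesgue_measure R).
Variable f : R -> R.
Hypothesis intf : mu.-integrable setT (EFin \o f).
Hypothesis f_cos : forall s : R, \int[mu]_x (f x * cos (s * x)) = 0.
Hypothesis f_sin : forall s : R, \int[mu]_x (f x * sin (s * x)) = 0.

Let measurable_trig (h : R -> R) (s : R) : continuous h -> measurable_fun setT (fun x :
  R => h (s * x)).
Proof.
move=> ch; apply: continuous_measurable_fun => x.
apply: (@continuous_comp _ _ _ (fun x => s * x) h); last exact: ch.
by apply: cvgM; [exact: cvg_cst|exact: cvg_id].
Qed.

Lemma integral_cos_shift (s y : R) : \int[mu]_x (f x * cos (s * (x - y))) = 0.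
Proof.
have ic := integrable_bounded_mul intf (measurable_trig s (@continuous_cos R)) (fun x
  => cos_max (s * x)).
have is_ := integrable_bounded_mul intf (measurable_trig s (@continuous_sin R)) (fun x
  => sin_max (s * x)).
transitivity (\int[mu]_x (cos (s * y) * (f x * cos (s * x)) + sin (s * y) * (f x * sin
  (s * x)))).
  by apply: eq_Rintegral => x _; rewrite mulrBr cosB; ring.
rewrite RintegralD//; [|exact: (integrableZl measurableT _ ic)|
  exact: (integrableZl measurableT _ is_)].
by rewrite !RintegralZl// f_cos f_sin !mulr0 addr0.
Qed.

Lemma integral_cauchy0 (r y : R) : 0 < r -> \int[mu]_x (f x * cauchy_kernel r (x - y))
  = 0.
Proof.
move=> r0.
pose k (p : R * R) := cos (p.2 * (p.1 - y)).
have mk : measurable_fun setT k.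
  apply: (measurableT_comp (continuous_measurable_fun (@continuous_cos R))).
  by apply: measurable_funM => //; exact: measurable_funB.
have := fubini_kernel intf (integrable_exponential_pdf r0) mk (fun p => cos_max _).
under eq_Rintegral do rewrite /k/= integral_poisson_kernel//.
move=> ->; under eq_Rintegral do rewrite /k/= integral_cos_shift mulr0.
by rewrite Rintegral_cst//= mul0r.
Qed.

Lemma atan_diff_le (a b : R) : `|atan a - atan b| <= pi.
Proof.
by have := atan_gtNpi2 a; have := atan_ltpi2 a; have := atan_gtNpi2 b;
  have := atan_ltpi2 b;
  rewrite ler_norml => *; apply/andP; split; lra.
Qed.

Lemma integrable_atan (r A B : R) :
  mu.-integrable setT (EFin \o (fun x => f x * (atan ((B - x) / r) - atan ((A - x) /
    r)))).
Proof.
have pi0 : pi != 0 :> R by rewrite gt_eqF// pi_gt0.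
(* Dividing by pi brings the kernel below 1 in absolute value, as [integrable_bounded_mul] asks. *)
pose k x := pi^-1 * (atan ((B - x) / r) - atan ((A - x) / r)).
have catan (C : R) : continuous (fun x => atan ((C - x) / r)).
  move=> x; apply: (@continuous_comp _ _ _ (fun x => (C - x) / r) atan);
    last exact: continuous_atan.
  apply: cvgM; last exact: cvg_cst.
  by apply: cvgB; [exact: cvg_cst|exact: cvg_id].
have mk : measurable_fun setT k.
  apply: continuous_measurable_fun => x; apply: cvgM; first exact: cvg_cst.
  by apply: cvgB; exact: catan.
have k1 x : `|k x| <= 1.
  rewrite normrM ger0_norm ?invr_ge0 ?pi_ge0// mulrC ler_pdivrMr ?pi_gt0// mul1r.
  exact: atan_diff_le.
have h := integrable_bounded_mul intf mk k1.
apply: eq_integrable (integrableZl measurableT pi h) => // x _.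
by rewrite /= -EFinM /k mulrCA [pi * (_ * _)]mulrA mulfV// mul1r.
Qed.

Lemma integral_atan0 (r A B : R) : 0 < r -> A < B ->
  \int[mu]_x (f x * (atan ((B - x) / r) - atan ((A - x) / r))) = 0.
Proof.
move=> r0 AB.
have mk : measurable_fun setT (fun p : R * R => cauchy_kernel r (p.1 - p.2)).
  apply: (measurableT_comp (continuous_measurable_fun (@continuous_cauchy_kernel _ r))).
  exact: measurable_funB.
have iI : mu.-integrable setT (EFin \o (\1_(`[A, B]) : R -> R)).
  exact: integrable_indic_itv.
have := fubini_kernel intf iI mk (fun p => cauchy_kernel_norm r _).
under eq_Rintegral do rewrite /= integral_cauchy_kernel//.
under [RHS]eq_Rintegral do rewrite /= integral_cauchy0// mulr0.
rewrite [RHS]Rintegral_cst//= mul0r => h.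
have rn : r != 0 by rewrite gt_eqF.
apply: (mulfI rn); rewrite mulr0 -{}h -RintegralZl//.
  by apply: eq_Rintegral => x _; ring.
exact: integrable_atan.
Qed.

(** The limit of atan (c n) for c != 0. The convention at c = 0 makes the difference at B - x and A
    - x equal to pi times the indicator of [A, B[ at every x, ends included. *)
Definition sgn_limit (c : R) : R := if 0 < c then pi / 2 else - (pi / 2).

Lemma cvg_atan_scale (c : R) : c != 0 -> atan (c * n.+1%:R) @[n --> \oo] --> sgn_limit c.
Proof.
move=> c0.
have h (d : R) : 0 < d -> atan (d * n.+1%:R) @[n --> \oo] --> pi / 2.
  move=> d0; apply: (@cvg_comp _ _ _ (fun n : nat => d * n.+1%:R) atan _ (pinfty_nbhs
    R)); last exact: cvgy_atan.
  apply/cvgryPge => M; near=> n.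
  rewrite -ler_pdivrMl// (@le_trans _ _ n%:R)// ?ler_nat//.
  by near: n; exact: nbhs_infty_ger.
rewrite /sgn_limit; case: ltP => [|c1]; first exact: h.
have cn : 0 < - c by rewrite oppr_gt0 lt_neqAle c0.
rewrite (_ : (fun n : nat => atan (c * n.+1%:R)) = (fun n => - atan (- c * n.+1%:R)));
  last first.
  by apply/funext => n; rewrite mulNr atanN opprK.
by apply: cvgN; exact: h.
Unshelve. all: by end_near. Qed.

Lemma integral_itv0 (A B : R) : A < B -> \int[mu]_(x in `[A, B[) f x = 0.
Proof.
move=> AB.
have /integrableP[/measurable_EFinP mf _] := intf.
(* The Cauchy scale is r = 1 / (n + 1); the arctangents then converge off A and B, dominated by
   pi. *)
pose D n x := atan ((B - x) * n.+1%:R) - atan ((A - x) * n.+1%:R).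
have D0 n : \int[mu]_x (f x * D n x) = 0.
  have := @integral_atan0 n.+1%:R^-1 A B _ AB; rewrite invrK; apply.
  by rewrite invr_gt0.
pose L x := sgn_limit (B - x) - sgn_limit (A - x).
have LE x : L x = pi * \1_(`[A, B[) x.
  rewrite /L /sgn_limit !subr_gt0 indicE.
  have -> : (x \in `[A, B[%classic) = (A <= x < B).
    by apply/idP/idP => [/set_mem|h]; [|apply: mem_set]; rewrite /= in_itv.
  case: (leP A x) => Ax /=; case: (ltP x B) => xB /=; rewrite ?mulr1 ?mulr0; try lra.
have iD n : mu.-integrable setT (EFin \o (fun x => f x * D n x)).
  have := @integrable_atan n.+1%:R^-1 A B; rewrite invrK; exact.
have mD n : measurable_fun setT (EFin \o (fun x => f x * D n x)).
  by have /integrableP[] := iD n.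
have mL : measurable_fun setT (EFin \o (fun x => f x * L x)).
  apply/measurable_EFinP; apply: measurable_funM => //.
  apply: (@eq_measurable_fun _ _ _ _ setT (fun x : R => pi * \1_(`[A, B[) x)).
    by move=> x _; rewrite LE.
  by apply: measurable_funM => //; exact: measurable_indic.
have cvD : {ae mu, forall x, setT x -> (EFin \o (fun x => f x * D n x)) x @[n --> \oo]
  --> (EFin \o (fun x => f x * L x)) x}.
  apply: ae_imp (ae_and (ae_neq A) (ae_neq B)) => x [xA xB] _.
  apply: cvg_EFin; first exact: nearW.
  apply: cvgM; first exact: cvg_cst.
  by apply: cvgB; apply: cvg_atan_scale; rewrite subr_eq0 eq_sym.
have ig : mu.-integrable setT (fun x => (pi%:E * `|(EFin \o f) x|)%E).
  exact: (integrableZl measurableT _ (integrable_abse intf)).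
have bD : {ae mu, forall x n, setT x -> (`|(EFin \o (fun x => f x * D n x)%R) x| <=
  pi%:E * `|(EFin \o f) x|)%E}.
  apply: aeW => x n _; rewrite /= lee_fin normrM mulrC ler_wpM2r//.
  exact: atan_diff_le.
have [iL _ cL] := @dominated_convergence _ _ _ mu setT measurableT
  (fun n => EFin \o (fun x => f x * D n x)) (EFin \o (fun x => f x * L x))
  (fun x => (pi%:E * `|(EFin \o f) x|)%E) mD mL cvD ig bD.
have : (\int[mu]_x (EFin \o (fun x => f x * L x)%R) x = 0)%E.
  apply: cvg_unique cL _ => //.
  rewrite (_ : [sequence _]_n = fun=> 0%E); first exact: cvg_cst.
  apply/funext => n /=; have := D0 n; rewrite /Rintegral => h.
  by rewrite -[LHS]fineK ?h//; exact: (integrable_fin_num measurableT (iD n)).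
move/(congr1 fine); rewrite -/(Rintegral mu setT (fun x => f x * L x)) /= => h.
have pi0 : pi != 0 :> R by rewrite gt_eqF// pi_gt0.
apply: (mulfI pi0); rewrite mulr0 -h.
rewrite Rintegral_mkcond -RintegralZl//.
  apply: eq_Rintegral => x _; rewrite LE patchE indicE; case: ifP => _;
    rewrite ?mulr1 ?mulr0//.
  by rewrite mulrC.
have mI : measurable_fun setT (\1_(`[A, B[) : R -> R) by exact: measurable_indic.
have i1 x : `|\1_(`[A, B[) x : R| <= 1 by rewrite indicE; case: (_ \in _);
  rewrite ?normr1 ?normr0.
apply: eq_integrable (integrable_bounded_mul intf mI i1) => // x _.
by rewrite /= patchE indicE; case: ifP => _; rewrite ?mulr1 ?mulr0.
Qed.

End fourier_uniqueness.

Section nnfun_fourier.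
Context {R : realType}.
Local Notation mu := (@lebesgue_measure R).
Implicit Types u v w : nnfun R.

Definition nncos (s : R) u := \int[mu]_x (fine (u x) * cos (s * x)).
Definition nnsin (s : R) u := \int[mu]_x (fine (u x) * sin (s * x)).

Definition nnint u := (\int[mu]_x u x < +oo)%E.

Lemma nnint_fin u : nnint u -> {ae mu, forall x, u x \is a fin_num}.
Proof.
move=> iu; have : mu.-integrable setT u.
  apply/integrableP; split; first exact: nnf_measurable.
  apply: le_lt_trans iu; rewrite le_eqVlt; apply/orP; left; apply/eqP.
  by apply: eq_integral => x _; rewrite gee0_abs ?nnf_ge0.
by move/(integrable_ae measurableT); apply: ae_imp => x; apply.
Qed.

Lemma measurable_fine_nnf u : measurable_fun setT (fun x => fine (u x)).
Proof.
exact: (measurableT_comp (@fine_measurable _ setT measurableT) (nnf_measurable u)).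
Qed.

Lemma integral_fine_nnf u D : nnint u -> measurable D ->
  (\int[mu]_(x in D) (fine (u x))%:E = \int[mu]_(x in D) u x)%E.
Proof.
move=> iu mD; apply: ge0_ae_eq_integral => //.
- by apply/measurable_EFinP; exact: measurable_funTS (measurable_fine_nnf u).
- exact: measurable_funTS (nnf_measurable u).
- by move=> x _; rewrite lee_fin fine_ge0 ?nnf_ge0.
- by move=> x _; exact: nnf_ge0.
by apply: ae_imp (nnint_fin iu) => x xf _; rewrite fineK.
Qed.

Lemma integrable_fine_nnf u : nnint u -> mu.-integrable setT (EFin \o (fun x => fine (u
  x))).
Proof.
move=> iu; apply/integrableP; split; first by apply/measurable_EFinP;
  exact: measurable_fine_nnf.
have iu' := iu; apply: le_lt_trans iu'; rewrite -(integral_fine_nnf iu)//.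
rewrite le_eqVlt; apply/orP; left; apply/eqP.
by apply: eq_integral => x _; rewrite gee0_abs// lee_fin fine_ge0 ?nnf_ge0.
Qed.

Lemma locint_nnint u : nnint u -> locint u.
Proof.
move=> iu x; apply: le_lt_trans iu; rewrite nnstep_convE.
by apply: ge0_subset_integral => //; [exact: nnf_measurable|move=> y _; exact: nnf_ge0].
Qed.

(** The difference u - v has zero integral on every [0, x[, so u and v have the same primitive and
    agree almost everywhere. *)
Lemma nnfun_fourier_inj u v : supp 0 u -> supp 0 v -> nnint u -> nnint v ->
  (forall s, nncos s u = nncos s v) -> (forall s, nnsin s u = nnsin s v) ->
  {ae mu, forall x, u x = v x}.
Proof.
move=> u0 v0 iu iv cuv suv.
have fu := integrable_fine_nnf iu; have fv := integrable_fine_nnf iv.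
have trig h : continuous h -> forall s, measurable_fun setT (fun x : R => h (s * x) : R).
  move=> ch s; apply: continuous_measurable_fun => x.
  apply: (@continuous_comp _ _ _ (fun x => s * x) h); last exact: ch.
  by apply: cvgM; [exact: cvg_cst|exact: cvg_id].
pose f x := fine (u x) - fine (v x).
have intf : mu.-integrable setT (EFin \o f) by exact: (integrableB measurableT fu fv).
have fc s : \int[mu]_x (f x * cos (s * x)) = 0.
  under eq_Rintegral do rewrite mulrBl.
  rewrite RintegralB//; first by rewrite -/(nncos s u) -/(nncos s v) cuv subrr.
  - exact: integrable_bounded_mul fu (trig _ (@continuous_cos R) s) (fun x => cos_max _).
  - exact: integrable_bounded_mul fv (trig _ (@continuous_cos R) s) (fun x => cos_max _).
have fs s : \int[mu]_x (f x * sin (s * x)) = 0.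
  under eq_Rintegral do rewrite mulrBl.
  rewrite RintegralB//; first by rewrite -/(nnsin s u) -/(nnsin s v) suv subrr.
  - exact: integrable_bounded_mul fu (trig _ (@continuous_sin R) s) (fun x => sin_max _).
  - exact: integrable_bounded_mul fv (trig _ (@continuous_sin R) s) (fun x => sin_max _).
apply: ae_eq_nnstep_conv; first exact: locint_nnint.
apply: nnfunP => x.
have [x0|x0] := leP x 0.
  rewrite -[LHS]/((nnstep ** u) x) -[RHS]/((nnstep ** v) x).
  have h w : supp 0 w -> (nnstep ** w) x = 0%E.
    by move=> w0; apply: (supp_conv (@supp_step R) w0); rewrite addr0.
  by rewrite !h.
have E w : supp 0 w -> nnint w -> ((nnstep ** w) x = \int[mu]_(y in `[0%R, x[) (fine (w
  y))%:E)%E.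
  move=> w0 iw; rewrite integral_fine_nnf// nnstep_convE.
  rewrite [LHS]integral_mkcond [RHS]integral_mkcond; apply: eq_integral => y _.
  have mE (i : interval R) : (y \in [set` i]) = (y \in i).
    by apply/idP/idP => [/set_mem//|h]; exact: mem_set.
  rewrite !patchE !mE !in_itv/=; case: (leP 0 y) => // /ltW y0 /=.
  by rewrite w0//; case: ifP.
rewrite !E//.
have fin w : nnint w -> (\int[mu]_(y in `[0%R, x[) (fine (w y))%:E)%E \is a fin_num.
  move=> iw; apply: integrable_fin_num => //.
  exact: (integrableS measurableT _ _ (integrable_fine_nnf iw)).
rewrite -[LHS]fineK ?fin// -[RHS]fineK ?fin//; congr EFin; apply/eqP;
  rewrite -subr_eq0; apply/eqP.
transitivity (\int[mu]_(y in `[0, x[) f y); last exact: integral_itv0.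
rewrite RintegralB//.
- exact: (integrableS measurableT _ _ fu).
- exact: (integrableS measurableT _ _ fv).
Qed.

End nnfun_fourier.

(** * The characteristic function *)

Section complex_limit.
Context {R : realType}.
Local Open Scope complex_scope.

Lemma mulc_real (x y c : R) : (x +i* y) * c%:C = (x * c) +i* (y * c).
Proof. by apply/eqP; rewrite eq_complex/= !mulr0 subr0 add0r !eqxx. Qed.

Lemma normc_le (x y : R) : `|x +i* y| <= (`|x| + `|y|)%:C.
Proof.
have -> : x +i* y = x%:C + (0 +i* y).
  by apply/eqP; rewrite eq_complex/= addr0 add0r !eqxx.
apply: le_trans (ler_normD _ _) _.
by rewrite !normc_def/= !expr0n/= addr0 add0r !sqrtr_sqr -rmorphD.
Qed.

Lemma cvg_complex (a b : nat -> R) (A B : R) : a @ \oo --> A -> b @ \oo --> B ->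
  ((fun n => a n +i* b n) : nat -> (R[i] : numFieldType)) @ \oo --> (A +i* B : (R[i] :
    numFieldType)).
Proof.
move=> aA bB; apply/cvgrPdist_lt => e; rewrite ltcE/= => /andP[/eqP e1 e0].
have e2 : 0 < complex.Re e / 2 by rewrite divr_gt0.
near=> n.
have -> : (A +i* B : (R[i] : numFieldType)) - (a n +i* b n) = (A - a n) +i* (B - b n).
  by apply/eqP; rewrite eq_complex/= !eqxx.
apply: le_lt_trans (normc_le _ _) _.
rewrite ltcE/= e1 eqxx/= [ltRHS]splitr ltrD//.
  by near: n; move/cvgrPdist_lt : aA; apply.
by near: n; move/cvgrPdist_lt : bB; apply.
Unshelve. all: by end_near. Qed.

(** Written in the shape of [cos_coeff] and [sin_coeff], so that the parts of the series become
    cosine and sine series. *)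
Lemma imag_exp (s : R) n : (0 +i* s) ^+ n =
  ((~~ odd n)%:R * (-1) ^+ n./2 * s ^+ n) +i* ((odd n)%:R * (-1) ^+ n.-1./2 * s ^+ n).
Proof.
elim: n => [|n ih].
  by apply/eqP; rewrite expr0 eq_complex/= !mul1r mul0r mul0r !eqxx.
apply/eqP; rewrite exprSr ih eq_complex /= !mulr0 sub0r addr0 negbK.
apply/andP; split; apply/eqP; last by rewrite exprSr; ring.
case: n {ih} => [|n]; first by rewrite /= !mul0r oppr0.
have -> : uphalf n.+1 = n./2.+1 by [].
by rewrite /= !exprSr; case: (odd n); rewrite /=; ring.
Qed.

End complex_limit.

Section dm_series.
Context {R : realType} (alpha : R).
Hypotheses (alpha_gt0 : 0 < alpha) (alpha_lt1 : alpha < 1).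
Local Notation mu := (@lebesgue_measure R).
Local Notation k := (nnk alpha_gt0).
Local Open Scope complex_scope.

(** The moment of K is 1/(m + 1 - alpha) - 1/(m + 1). With n = m + 1, the term alpha/(n - alpha)
    (is)^n / n! is is times [kmoment m] (is)^m / m!. *)
Definition kmoment (m : nat) : R := alpha / (m.+1%:R * (m.+1%:R - alpha)).

Let den_gt0 m : 0 < m.+1%:R - alpha.
Proof. by rewrite subr_gt0 (lt_le_trans alpha_lt1)// ler1n. Qed.

Lemma integral_nnk_moment (m : nat) : (\int[mu]_x (dmk alpha x * x ^+ m)%:E = (kmoment
  m)%:E)%E.
Proof.
have d1 : 0 < m.+1%:R :> R by rewrite ltr0n.
have h1 : (\int[mu]_(y in `]-oo, 1%R[) nnpow m.+1%:R y = (m.+1%:R^-1)%:E :> \bar R)%E.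
  rewrite -nnstep_convE nnstep_conv_nnpow// nnscaleE ?invr_ge0 ?ltW//=.
  by rewrite /pow_density ltr01 powR1 mule1.
have h2 : (\int[mu]_(y in `]-oo, 1%R[) nnpow (m.+1%:R - alpha) y = ((m.+1%:R -
  alpha)^-1)%:E)%E.
  rewrite -nnstep_convE nnstep_conv_nnpow// nnscaleE ?invr_ge0 ?ltW//=.
  by rewrite /pow_density ltr01 powR1 mule1.
have p0 (x : R) : 0 <= dmk alpha x * x ^+ m.
  rewrite /dmk; case: ifP => [/andP[x0 x1]|]; last by rewrite mul0r.
  have := dmk_ge0 alpha_gt0 x; rewrite /dmk x0 x1 => h.
  by rewrite mulr_ge0// exprn_ge0// ltW.
have mp : measurable_fun setT (fun x : R => dmk alpha x * x ^+ m).
  by apply: measurable_funM; [exact: measurable_dmk|exact: measurable_funX].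
have e : (\int[mu]_x (dmk alpha x * x ^+ m)%:E =
    \int[mu]_(x in `]-oo, 1%R[) (dmk alpha x * x ^+ m)%:E)%E.
  rewrite [RHS]integral_mkcond; apply: eq_integral => y _.
  have mE (i : interval R) : (y \in [set` i]) = (y \in i).
    by apply/idP/idP => [/set_mem//|h]; exact: mem_set.
  by rewrite patchE mE in_itv/= /dmk; case: (ltP y 1) => y1 //=; rewrite ?andbF ?mul0r.
(* The mass of x^m on ]0, 1[ is added rather than subtracted, so that all integrands stay
   nonnegative. *)
have e2 : (\int[mu]_(x in `]-oo, 1%R[) (dmk alpha x * x ^+ m)%:E + (m.+1%:R^-1)%:E =
    ((m.+1%:R - alpha)^-1)%:E)%E.
  rewrite -h1 -h2 -ge0_integralD//; last 4 first.
  - by move=> y _; rewrite lee_fin.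
  - by apply/measurable_EFinP; exact: measurable_funTS mp.
  - by move=> y _; exact: nnf_ge0.
  - exact: measurable_funTS (nnf_measurable _).
  apply: eq_integral => y; rewrite inE/= in_itv/= => y1.
  rewrite -EFinD; congr EFin; rewrite /dmk /pow_density y1 andbT.
  case: ifP => y0; last by rewrite mul0r addr0.
  have -> : m.+1%:R - 1 = m%:R :> R by rewrite -natr1; ring.
  have -> : m.+1%:R - alpha - 1 = m%:R + - alpha :> R by rewrite -natr1; ring.
  rewrite powRD; last by rewrite (gt_eqF y0) implybT.
  rewrite !powR_mulrn ?(ltW y0)//.
  by ring.
have sub (X : \bar R) (x y : R) : (X + x%:E = y%:E)%E -> X = (y - x)%:E.
  by case: X => [r| |]//; rewrite -EFinD => -[<-]; rewrite addrK.
rewrite e (sub _ _ _ e2); congr EFin; rewrite /kmoment.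
move: (m.+1%:R : R) d1 (den_gt0 m) => p pp pa.
by field; rewrite !gt_eqF.
Qed.

Lemma nnint_nnk : nnint k.
Proof.
rewrite /nnint; have := integral_nnk_moment 0.
under eq_integral do rewrite mulr1.
by rewrite -[X in (X < _)%E]/(\int[mu]_x (dmk alpha x)%:E)%E => ->; rewrite ltry.
Qed.

Lemma integrable_nnk_mul (h : R -> R) (B : R) : measurable_fun setT h ->
  (forall u, 0 < u < 1 -> `|h u| <= B) ->
  mu.-integrable setT (EFin \o (fun u => dmk alpha u * h u)).
Proof.
move=> mh hB.
have ik := integrable_fine_nnf nnint_nnk.
apply: le_integrable (integrableZl measurableT B ik) => //.
  by apply/measurable_EFinP; apply: measurable_funM => //; exact: measurable_dmk.
move=> u _; rewrite -EFinM /= lee_fin !normrM mulrC.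
rewrite /dmk; case: ifP => u01; last by rewrite normr0 !mulr0.
by rewrite ler_wpM2r// (le_trans (hB u u01))// ler_norm.
Qed.

(** Covers sine and cosine at once. K lives on ]0, 1[, where the partial sums at s u are bounded by
    e^{|s|}; dominated convergence exchanges the series with the integral against K. *)
Lemma cvg_kmoment_series (c : R -> nat -> R) (C : R -> R) (s : R) :
  (forall v u m, c (v * u) m = c v m * u ^+ m) ->
  (forall v m, `|c v m| <= exp_coeff `|v| m) ->
  (forall v, series (c v) @ \oo --> C v) -> continuous C ->
  (fun N => \sum_(0 <= m < N) c s m * kmoment m) @ \oo -->
  \int[mu]_u (fine (k u) * C (s * u)).
Proof.
move=> cM cexp cC contC.
have serE N u : series (c (s * u)) N = \sum_(0 <= m < N) c s m * u ^+ m.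
  by rewrite /series/=; apply: eq_bigr => m _; rewrite cM.
have mser N : measurable_fun setT (fun u : R => series (c (s * u)) N).
  under eq_fun do rewrite serE.
  apply: measurable_sum => m; apply: measurable_funM => //; exact: measurable_funX.
have bser N u : 0 < u < 1 -> `|series (c (s * u)) N| <= expR `|s|.
  move=> /andP[u0 u1].
  apply: (@le_trans _ _ (series (exp_coeff `|s|) N)); last first.
    rewrite /expR; apply: nondecreasing_cvgn_le; last exact: is_cvg_series_exp_coeff.
    apply/nondecreasing_seqP => n; rewrite seriesSr lerDl.
    by rewrite exp_coeff_ge0.
  rewrite /series/=; apply: le_trans (ler_norm_sum _ _ _) _; apply: ler_sum => m _.
  apply: le_trans (cexp _ _) _; rewrite /exp_coeff/= ler_wpM2r ?invr_ge0 ?ler0n//.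
  rewrite lerXn2r ?nnegrE// normrM ler_piMr// ger0_norm ?(ltW u0)//; exact: ltW.
have mC : measurable_fun setT (fun u : R => C (s * u)).
  apply: continuous_measurable_fun => x.
  apply: (@continuous_comp _ _ _ (fun x => s * x) C); last exact: contC.
  by apply: cvgM; [exact: cvg_cst|exact: cvg_id].
have iser N := integrable_nnk_mul (mser N) (bser N).
have mf N : measurable_fun setT (EFin \o (fun u => dmk alpha u * series (c (s * u)) N)).
  by have /integrableP[] := iser N.
have mCk : measurable_fun setT (EFin \o (fun u => dmk alpha u * C (s * u))).
  by apply/measurable_EFinP; apply: measurable_funM => //; exact: measurable_dmk.
have cvf : {ae mu, forall u, setT u -> (EFin \o (fun u => dmk alpha u * series (c (s *
  u)) N)) u @[N --> \oo] --> (EFin \o (fun u => dmk alpha u * C (s * u))) u}.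
  apply: aeW => u _; apply: cvg_EFin; first exact: nearW.
  by apply: cvgM; [exact: cvg_cst|exact: cC].
have ig : mu.-integrable setT (EFin \o (fun u => dmk alpha u * expR `|s|)).
  apply: (@integrable_nnk_mul _ (expR `|s|)) => // u _.
  by rewrite ger0_norm ?expR_ge0.
have bf : {ae mu, forall u N, setT u -> (`|(EFin \o (fun u => dmk alpha u * series (c
  (s * u)) N)%R) u| <= (EFin \o (fun u => dmk alpha u * expR `|s|)%R) u)%E}.
  apply: aeW => u N _; rewrite /= lee_fin normrM ger0_norm ?dmk_ge0//.
  rewrite /dmk; case: ifP => u01; last by rewrite !mul0r.
  have := dmk_ge0 alpha_gt0 u; rewrite /dmk u01 => h.
  by rewrite ler_wpM2l// bser.
have [iC _ cI] := @dominated_convergence _ _ _ mu setT measurableT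
  (fun N => EFin \o (fun u => dmk alpha u * series (c (s * u)) N))
  (EFin \o (fun u => dmk alpha u * C (s * u))) (EFin \o (fun u => dmk alpha u * expR
    `|s|))
  mf mCk cvf ig bf.
have E N : (\int[mu]_u (EFin \o (fun u => dmk alpha u * series (c (s * u)) N)%R) u =
   (\sum_(0 <= m < N) c s m * kmoment m)%:E)%E.
  elim: N => [|N ih].
    rewrite big_geq//; apply: integral0_eq => u _ /=.
    by rewrite /series/= big_geq// mulr0.
  rewrite big_nat_recr//= EFinD -ih.
  have im : mu.-integrable setT (EFin \o (fun u => dmk alpha u * u ^+ N)).
    apply: (@integrable_nnk_mul _ 1); first exact: measurable_funX.
    move=> u /andP[u0 u1]; rewrite normrX exprn_ile1// ger0_norm ?ltW//.
  transitivity (\int[mu]_u ((EFin \o (fun u => dmk alpha u * series (c (s * u)) N)%R) u +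
     (c s N)%:E * (EFin \o (fun u => dmk alpha u * u ^+ N)%R) u))%E.
    apply: eq_integral => u _; rewrite /= seriesSr cM -EFinM -EFinD; congr EFin; ring.
  rewrite integralD//; last exact: (integrableZl measurableT _ im).
  by rewrite (integralZl measurableT im) [X in (_ + _ * X)%E]integral_nnk_moment.
have cI' : (fun N => (\sum_(0 <= m < N) c s m * kmoment m)%:E) @ \oo -->
    (\int[mu]_u (fine (k u) * C (s * u)))%:E.
  have -> : (\int[mu]_u (fine (k u) * C (s * u)))%:E =
      (\int[mu]_u (EFin \o (fun u => dmk alpha u * C (s * u))%R) u)%E.
    by rewrite /Rintegral fineK//; exact: integrable_fin_num iC.
  by under eq_fun do rewrite -E.
exact: (fine_cvg cI').
Qed.

Lemma dm_seriesE s N : dm_series alpha s N.+1 =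
  (- s * \sum_(0 <= m < N) sin_coeff s m * kmoment m) +i*
  (s * \sum_(0 <= m < N) cos_coeff s m * kmoment m).
Proof.
elim: N => [|N ih].
  by rewrite /dm_series !big_geq// !mulr0.
rewrite /dm_series big_nat_recr//= -/(dm_series alpha s N.+1) ih.
have -> : (N.+1`!)%:R^-1 = ((N.+1`!)%:R^-1)%:C :> R[i] by rewrite fmorphV rmorph_nat.
rewrite imag_exp mulc_real [(alpha / _)%:C * _]mulrC mulc_real.
have n0 : (N`!)%:R != 0 :> R by rewrite pnatr_eq0 -lt0n fact_gt0.
have n1 : N.+1%:R != 0 :> R by rewrite pnatr_eq0.
have n2 : N.+1%:R - alpha != 0 by rewrite gt_eqF.
apply/eqP; rewrite eq_complex/= !big_nat_recr//=; apply/andP; split; apply/eqP.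
  rewrite mulrDr; congr (_ + _); rewrite /sin_coeff/= /kmoment factS natrM exprSr negbK.
  have -> : (odd N)%:R * (-1) ^+ uphalf N = - ((odd N)%:R * (-1) ^+ N.-1./2) :> R.
    by case: N {ih n0 n1 n2} => [|N]; rewrite ?mul0r ?oppr0//= exprS; ring.
  by move: (N.+1%:R : R) n1 n2 => p n1 n2; field; rewrite n0 n1 n2.
rewrite mulrDr; congr (_ + _); rewrite /cos_coeff/= /kmoment factS natrM exprSr -exprnP.
by move: (N.+1%:R : R) n1 n2 => p n1 n2; field; rewrite n0 n1 n2.
Qed.

Lemma normr_coeff_le (b : bool) (e m : nat) (v : R) :
  `|b%:R * (-1) ^+ e * v ^+ m / m`!%:R| <= exp_coeff `|v| m.
Proof.
rewrite /exp_coeff/= !normrM normrX normrN1 expr1n mulr1 normrX.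
rewrite [`|_^-1|]ger0_norm ?invr_ge0 ?ler0n// ler_wpM2r ?invr_ge0 ?ler0n//.
by rewrite ler_piMl ?exprn_ge0//; case: b; rewrite ?normr1 ?normr0.
Qed.

Lemma limn_dm_series s : limn (dm_series alpha s : nat -> (R[i] : numFieldType)) =
  (0 +i* s) * (nncos s k +i* nnsin s k).
Proof.
apply: cvg_lim; first exact: norm_hausdorff.
have cs : (fun N => \sum_(0 <= m < N) sin_coeff s m * kmoment m) @ \oo --> nnsin s k.
  apply: cvg_kmoment_series; [ | | |exact: continuous_sin].
  - by move=> v u m; rewrite /sin_coeff/= exprMn; ring.
  - by move=> v m; exact: normr_coeff_le.
  - by move=> v; rewrite unlock; exact: is_cvg_series_sin_coeff.
have cc : (fun N => \sum_(0 <= m < N) cos_coeff s m * kmoment m) @ \oo --> nncos s k.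
  apply: cvg_kmoment_series; [ | | |exact: continuous_cos].
  - by move=> v u m; rewrite /cos_coeff/= exprMn; ring.
  - by move=> v m; rewrite /cos_coeff/= -exprnP; exact: normr_coeff_le.
  - by move=> v; rewrite unlock; exact: is_cvg_series_cos_coeff.
have -> : (0 +i* s) * (nncos s k +i* nnsin s k) = (- s * nnsin s k) +i* (s * nncos s k).
  by apply/eqP; rewrite eq_complex/= !mul0r sub0r add0r mulNr !eqxx.
rewrite -(cvg_shiftS (dm_series alpha s : nat -> (R[i] : numFieldType))).
under eq_fun do rewrite dm_seriesE.
by apply: cvg_complex; (apply: cvgM; [exact: cvg_cst|]).
Qed.

End dm_series.

(** * Transforms of translates and convolutions *)

Section transforms.
Context {R : realType}.
Local Notation mu := (@lebesgue_measure R).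
Implicit Types u v w : nnfun R.

Definition nntrans (phi : R -> R) u := \int[mu]_x (fine (u x) * phi x).

Definition bounded1 (phi : R -> R) := measurable_fun setT phi /\ forall x, `|phi x| <= 1.

Lemma bounded1_cst : bounded1 (fun=> 1).
Proof. by split => // x; rewrite normr1. Qed.

Lemma bounded1_trans phi c : bounded1 phi -> bounded1 (fun x => phi (x + c)).
Proof.
by move=> [mp p1]; split => // ; apply: (measurableT_comp mp); exact: measurable_funD.
Qed.

Lemma integrable_trans phi u : nnint u -> bounded1 phi ->
  mu.-integrable setT (EFin \o (fun x => fine (u x) * phi x)).
Proof. by move=> iu [mp p1]; exact: integrable_bounded_mul (integrable_fine_nnf iu) mp
  p1. Qed.

(* The function [1 + phi] is nonnegative, which reduces statements on [phi] to
   Tonelli's theorem. *)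
Lemma integral_1D phi u : nnint u -> bounded1 phi ->
  (\int[mu]_x (u x * (1 + phi x)%:E) = (nntrans (fun=> 1%R) u + nntrans phi u)%:E)%E.
Proof.
move=> iu bp; have i1 := integrable_trans iu bounded1_cst;
  have ip := integrable_trans iu bp.
have p0 x : 0 <= 1 + phi x.
  by have := bp.2 x; rewrite ler_norml => /andP[h _]; lra.
have m1 : measurable_fun setT (fun x => 1 + phi x).
  by apply: measurable_funD => //; exact: bp.1.
transitivity (\int[mu]_x (fine (u x) * 1 + fine (u x) * phi x)%:E)%E.
  apply: ge0_ae_eq_integral => //.
  - apply: emeasurable_funM; first exact: nnf_measurable.
    exact/measurable_EFinP.
  - apply/measurable_EFinP; apply: measurable_funD; apply: measurable_funM => //.
    + exact: measurable_fine_nnf.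
    + exact: measurable_fine_nnf.
    + exact: bp.1.
  - by move=> x _; rewrite mule_ge0 ?nnf_ge0// lee_fin.
  - by move=> x _; rewrite lee_fin -mulrDr mulr_ge0// fine_ge0 ?nnf_ge0.
  apply: ae_imp (nnint_fin iu) => x xf _.
  by rewrite -{1}(fineK xf) -EFinM; congr EFin; ring.
rewrite /nntrans -RintegralD// /Rintegral fineK//.
exact: (integrable_fin_num measurableT (integrableD measurableT i1 ip)).
Qed.

Lemma nntrans_add phi u v : nnint u -> nnint v -> bounded1 phi ->
  nntrans phi (nnadd u v) = nntrans phi u + nntrans phi v.
Proof.
move=> iu iv bp; rewrite /nntrans -RintegralD//; [|exact: integrable_trans|
  exact: integrable_trans].
rewrite /Rintegral; congr fine; apply: ae_eq_integral => //.
- apply/measurable_EFinP; apply: measurable_funM; [exact: measurable_fine_nnf|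
  exact: bp.1].
- apply/measurable_EFinP; apply: measurable_funD; apply: measurable_funM;
   [exact: measurable_fine_nnf|exact: bp.1|exact: measurable_fine_nnf|exact: bp.1].
apply: ae_imp (ae_and (nnint_fin iu) (nnint_fin iv)) => x [xu xv] _.
by rewrite /= fineD// mulrDl.
Qed.

Lemma nnint_add u v : nnint u -> nnint v -> nnint (nnadd u v).
Proof.
move=> iu iv; rewrite /nnint /= ge0_integralD//.
- exact: lte_add_pinfty.
- by move=> x _; exact: nnf_ge0.
- exact: nnf_measurable.
- by move=> x _; exact: nnf_ge0.
- exact: nnf_measurable.
Qed.

Lemma nnint_shift h u : nnint u -> nnint (nnshift h u).
Proof.
rewrite /nnint => iu; rewrite (_ : (\int[mu]_x nnshift h u x)%E = (\int[mu]_x u x)%E)//.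
by rewrite -[RHS](@ge0_integral_translation _ _ (- h))//; [exact: nnf_measurable|
  exact: nnf_ge0].
Qed.

Lemma nnint_conv u v : nnint u -> nnint v -> nnint (u ** v).
Proof.
rewrite /nnint => iu iv; rewrite integral_nnconv lte_mul_pinfty ?integral_ge0//.
- by move=> x _; exact: nnf_ge0.
- rewrite ge0_fin_numE//; apply: integral_ge0 => x _; exact: nnf_ge0.
Qed.

Lemma nntrans1E u : nnint u -> (nntrans (fun=> 1) u)%:E = (\int[mu]_x u x)%E.
Proof.
move=> iu; rewrite -(integral_fine_nnf iu)// /nntrans /Rintegral.
under eq_integral do rewrite mulr1.
rewrite fineK//; exact: (integrable_fin_num measurableT (integrable_fine_nnf iu)).
Qed.

Lemma nntrans_shift phi h u : nnint u -> bounded1 phi ->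
  nntrans phi (nnshift h u) = nntrans (fun x => phi (x + h)) u.
Proof.
move=> iu bp; have bph := bounded1_trans h bp.
have e1 := integral_1D (nnint_shift h iu) bp.
have e2 := integral_1D iu bph.
have e3 : (\int[mu]_x nnshift h u x)%E = (\int[mu]_x u x)%E.
  by rewrite -[RHS](@ge0_integral_translation _ _ (- h))//; [exact: nnf_measurable|
    exact: nnf_ge0].
rewrite -(nntrans1E iu) -(nntrans1E (nnint_shift h iu)) in e3; case: e3 => e3.
have : (\int[mu]_x (nnshift h u x * (1 + phi x)%:E) = \int[mu]_x (u x * (1 + phi (x +
  h)%R)%:E))%E.
  rewrite -[RHS](@ge0_integral_translation _ _ (- h)).
  - by apply: eq_integral => x _; rewrite /= subrK.
  - apply: emeasurable_funM; first exact: nnf_measurable.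
    by apply/measurable_EFinP; apply: measurable_funD => //; exact: bph.1.
  - move=> x; rewrite mule_ge0 ?nnf_ge0// lee_fin.
    by have := bph.2 x; rewrite ler_norml => /andP[? _]; lra.
by rewrite e1 e2 e3 => -[] /addrI.
Qed.

Lemma integral_conv_mul u v (w : nnfun R) :
  (\int[mu]_x ((u ** v) x * w x) = \int[mu]_y (u y * \int[mu]_z (v z * w (y + z)%R)))%E.
Proof.
pose F (p : R * R) := (u p.2 * v (p.1 - p.2)%R * w p.1)%E.
have mF : measurable_fun setT F.
  apply: emeasurable_funM; first exact: measurable_conv_integrand.
  exact: (measurableT_comp (nnf_measurable w)).
have F0 p : (0 <= F p)%E by rewrite /F !mule_ge0 ?nnf_ge0.
transitivity (\int[mu]_x \int[mu]_y F (x, y))%E.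
  apply: eq_integral => x _; rewrite nnconvE -ge0_integralZr//.
  - exact: measurable_conv_integrand1.
  - by move=> y _; exact: conv_integrand_ge0.
  - exact: nnf_ge0.
rewrite (@fubini_tonelli _ _ _ _ R mu mu F mF F0).
apply: eq_integral => y _; rewrite -ge0_integralZl//; last 3 first.
- apply: emeasurable_funM; first exact: nnf_measurable.
  by apply: (measurableT_comp (nnf_measurable w)); exact: measurable_funD.
- by move=> z _; rewrite mule_ge0 ?nnf_ge0.
- exact: nnf_ge0.
rewrite -[RHS](@ge0_integral_translation _ _ (- y)).
- by apply: eq_integral => x _; rewrite /F/= muleA; congr (_ * w _)%E; ring.
- apply: emeasurable_funM => //; apply: emeasurable_funM; first exact: nnf_measurable.
  by apply: (measurableT_comp (nnf_measurable w)); exact: measurable_funD.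
- by move=> z; rewrite !mule_ge0 ?nnf_ge0.
Qed.

(** The hypothesis on [phi] is the common shape of the addition formulas of cos and sin. Tonelli is
    applied to 1 + phi, and the product of the masses is then cancelled. *)
Lemma nntrans_conv (phi p1 q1 p2 q2 : R -> R) u v : nnint u -> nnint v ->
  bounded1 phi -> bounded1 p1 -> bounded1 q1 -> bounded1 p2 -> bounded1 q2 ->
  (forall y z, phi (y + z) = p1 y * q1 z + p2 y * q2 z) ->
  nntrans phi (u ** v) = nntrans p1 u * nntrans q1 v + nntrans p2 u * nntrans q2 v.
Proof.
move=> iu iv bp bp1 bq1 bp2 bq2 E.
have p0 x : 0 <= 1 + phi x.
  by have := bp.2 x; rewrite ler_norml => /andP[h _]; lra.
have m1 : measurable_fun setT (fun x => 1 + phi x).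
  by apply: measurable_funD => //; exact: bp.1.
have := integral_conv_mul u v (nnreal m1 p0).
rewrite -[LHS]/(\int[mu]_x ((u ** v) x * (1 + phi x)%:E))%E integral_1D//;
  last exact: nnint_conv.
set I := nntrans (fun=> 1).
have inner (y : R) : (\int[mu]_z (v z * nnreal m1 p0 (y + z)%R) =
    (I v + (p1 y * nntrans q1 v + p2 y * nntrans q2 v))%:E)%E.
  have b : bounded1 (fun z => phi (y + z)).
    have [h1 h2] := bounded1_trans y bp; split => [|z]; last by rewrite addrC; exact: h2.
    by under eq_fun do rewrite addrC.
  rewrite -[LHS]/(\int[mu]_z (v z * (1 + phi (y + z)%R)%:E))%E integral_1D//;
    congr (_ + _)%:E.
  rewrite /nntrans; under eq_Rintegral do rewrite E mulrDr [_ * (p1 y * _)]mulrCA [_ *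
    (p2 y * _)]mulrCA.
  have h1 := integrable_trans iv bq1; have h2 := integrable_trans iv bq2.
  rewrite RintegralD//; [|exact: (integrableZl measurableT _ h1)|
    exact: (integrableZl measurableT _ h2)].
  by rewrite !RintegralZl.
under [X in _ = X -> _]eq_integral do rewrite inner.
have i1 := integrable_trans iu bp1; have i2 := integrable_trans iu bp2.
have i0 := integrable_trans iu bounded1_cst.
have -> : (\int[mu]_y (u y * (I v + (p1 y * nntrans q1 v + p2 y * nntrans q2 v))%:E) =
    (I u * I v + (nntrans p1 u * nntrans q1 v + nntrans p2 u * nntrans q2 v))%:E)%E.
  pose f (y : R) := I v * (fine (u y) * 1) + (nntrans q1 v * (fine (u y) * p1 y) +
    nntrans q2 v * (fine (u y) * p2 y)).
  have j0 : mu.-integrable setT (EFin \o (fun y => I v * (fine (u y) * 1))) :=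
    integrableZl measurableT _ i0.
  have j1 : mu.-integrable setT (EFin \o (fun y => nntrans q1 v * (fine (u y) * p1 y)))
    := integrableZl measurableT _ i1.
  have j2 : mu.-integrable setT (EFin \o (fun y => nntrans q2 v * (fine (u y) * p2 y)))
    := integrableZl measurableT _ i2.
  have j12 : mu.-integrable setT (EFin \o (fun y => nntrans q1 v * (fine (u y) * p1 y)
    + nntrans q2 v * (fine (u y) * p2 y))) := integrableD measurableT j1 j2.
  have jf : mu.-integrable setT (EFin \o f) := integrableD measurableT j0 j12.
  transitivity (\int[mu]_y (f y)%:E)%E.
    apply: ae_eq_integral => //.
    - apply: emeasurable_funM; first exact: nnf_measurable.
      apply/measurable_EFinP; apply: measurable_funD => //.
      by apply: measurable_funD; apply: measurable_funM => //; [exact: bp1.1|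
        exact: bp2.1].
    - by have /integrableP[] := jf.
    apply: ae_imp (nnint_fin iu) => y yf _.
    by rewrite -(fineK yf) -EFinM /f /= ; congr EFin; ring.
  rewrite -[LHS]fineK; last exact: (integrable_fin_num measurableT jf).
  congr EFin; rewrite -/(Rintegral mu setT f) /f RintegralD// RintegralD// !RintegralZl//.
  by rewrite -/(nntrans p1 u) -/(nntrans p2 u) -/(nntrans (fun=> 1) u) -/I; ring.
have -> : I (u ** v) = I u * I v.
  apply: EFin_inj; rewrite EFinM /I !nntrans1E//; last exact: nnint_conv.
  exact: integral_nnconv.
by move=> [] /addrI.
Qed.

End transforms.

Section bounded_interval.
Context {R : realType}.
Local Notation mu := (@lebesgue_measure R).
Variable h : R.
Hypothesis h0 : 0 < h.

(** An integrable substitute for H, equal to it on ]-oo, h[. *)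
Definition box (x : R) : R := if (0 < x) && (x < h) then 1 else 0.

Lemma measurable_box : measurable_fun setT box.
Proof.
apply: measurable_fun_ifT => //.
by apply: measurable_and; exact: measurable_fun_ltr.
Qed.

Lemma box_ge0 x : 0 <= box x. Proof. by rewrite /box; case: ifP. Qed.

Definition nnbox := nnreal measurable_box box_ge0.

Lemma supp_nnbox : supp 0 nnbox.
Proof. by move=> x x0 /=; rewrite /box ltNge x0. Qed.

Lemma integral_box (f : R -> R) : (\int[mu]_x (box x * f x)%:E = \int[mu]_(x in `]0%R,
  h[) (f x)%:E)%E.
Proof.
rewrite [RHS]integral_mkcond; apply: eq_integral => x _.
rewrite patchE; have -> : (x \in `]0, h[%classic) = (0 < x < h).
  by apply/idP/idP => [/set_mem|?]; [|apply: mem_set]; rewrite /= in_itv.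
by rewrite /box; case: ifP => _; rewrite ?mul1r ?mul0r.
Qed.

Lemma nnint_nnbox : nnint nnbox.
Proof.
rewrite /nnint; have := integral_box (cst 1).
under eq_integral do rewrite mulr1.
rewrite -[X in (X < _)%E]/(\int[mu]_x (box x)%:E)%E => ->.
rewrite -[X in (X < _)%E]/(\int[mu]_(x in `]0%R, h[) cst 1 x)%E.
by rewrite integral_cst//= lebesgue_measure_itv/= lte_fin h0 mul1e -EFinB ltry.
Qed.

Lemma integral_box_derive (F f : R -> R) : continuous f ->
  (forall x : R, is_derive x 1 F (f x)) -> \int[mu]_x (box x * f x) = F h - F 0.
Proof.
move=> cf dF; have cF : continuous F.
  by move=> x; have [d _] := dF x; apply: differentiable_continuous;
    exact/derivable1_diffP.
rewrite /Rintegral integral_box.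
have mf : measurable_fun setT (EFin \o f) by apply/measurable_EFinP;
  exact: continuous_measurable_fun.
rewrite integral_itv_bndo_bndc; last exact: measurable_funTS mf.
rewrite integral_itv_obnd_cbnd; last exact: measurable_funTS mf.
rewrite (@continuous_FTC2 _ f F)//.
- exact: continuous_subspaceT.
- split; [by move=> x _; have [] := dF x|exact/cvg_at_right_filter/cF|
  exact/cvg_at_left_filter/cF].
- by move=> x _; rewrite derive1E; have [_ ->] := dF x.
Qed.

(** With [nnsin_nnbox], the identity is times the transform = e^{ish} - 1, kept in product form so
    that s = 0 is included. *)
Lemma nncos_nnbox s : s * nncos s nnbox = sin (s * h).
Proof.
have cc : continuous (fun x : R => cos (s * x)).
  move=> x; apply: (@continuous_comp _ _ _ (fun x => s * x) cos);
    last exact: continuous_cos.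
  by apply: cvgM; [exact: cvg_cst|exact: cvg_id].
have -> : s * nncos s nnbox = \int[mu]_x (box x * (s * cos (s * x))).
  rewrite /nncos /= -RintegralZl//.
    by apply: eq_Rintegral => x _; rewrite mulrCA.
  apply: integrable_bounded_mul (integrable_fine_nnf nnint_nnbox) _ (fun x => cos_max _).
  exact: continuous_measurable_fun.
have cf : continuous (fun x : R => s * cos (s * x)).
  by move=> x; apply: cvgM; [exact: cvg_cst|exact: cc].
have dF (x : R) : is_derive x 1 (fun x => sin (s * x)) (s * cos (s * x)).
  by apply: is_derive_eq; rewrite /GRing.scale/=; ring.
by rewrite (integral_box_derive cf dF) mulr0 sin0 subr0.
Qed.

Lemma nnsin_nnbox s : s * nnsin s nnbox = 1 - cos (s * h).
Proof.
have cc : continuous (fun x : R => sin (s * x)).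
  move=> x; apply: (@continuous_comp _ _ _ (fun x => s * x) sin);
    last exact: continuous_sin.
  by apply: cvgM; [exact: cvg_cst|exact: cvg_id].
have -> : s * nnsin s nnbox = \int[mu]_x (box x * (s * sin (s * x))).
  rewrite /nnsin /= -RintegralZl//.
    by apply: eq_Rintegral => x _; rewrite mulrCA.
  apply: integrable_bounded_mul (integrable_fine_nnf nnint_nnbox) _ (fun x => sin_max _).
  exact: continuous_measurable_fun.
have cf : continuous (fun x : R => s * sin (s * x)).
  by move=> x; apply: cvgM; [exact: cvg_cst|exact: cc].
have dF (x : R) : is_derive x 1 (fun x => - cos (s * x)) (s * sin (s * x)).
  by apply: is_derive_eq; rewrite /GRing.scale/=; ring.
by rewrite (integral_box_derive cf dF) mulr0 cos0 opprK addrC.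
Qed.

End bounded_interval.

Section trig_transforms.
Context {R : realType}.
Local Notation mu := (@lebesgue_measure R).
Implicit Types u v : nnfun R.

Lemma bounded1_cos (s : R) : bounded1 (fun x => cos (s * x)).
Proof.
split => [|x]; last exact: cos_max.
apply: continuous_measurable_fun => x.
apply: (@continuous_comp _ _ _ (fun x => s * x) cos); last exact: continuous_cos.
by apply: cvgM; [exact: cvg_cst|exact: cvg_id].
Qed.

Lemma bounded1_sin (s : R) : bounded1 (fun x => sin (s * x)).
Proof.
split => [|x]; last exact: sin_max.
apply: continuous_measurable_fun => x.
apply: (@continuous_comp _ _ _ (fun x => s * x) sin); last exact: continuous_sin.
by apply: cvgM; [exact: cvg_cst|exact: cvg_id].
Qed.

Lemma nncos_conv s u v : nnint u -> nnint v ->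
  nncos s (u ** v) = nncos s u * nncos s v - nnsin s u * nnsin s v.
Proof.
move=> iu iv; have bc := bounded1_cos s; have bs := bounded1_sin s.
have bsN : bounded1 (fun x => - sin (s * x)).
  by split => [|x]; [apply: measurable_funN; exact: bs.1|rewrite normrN; exact: bs.2].
rewrite [LHS](@nntrans_conv _ _ _ _ _ _ u v iu iv bc bc bc bsN bs).
  congr (_ + _); rewrite -mulNr; congr (_ * _).
  rewrite /nntrans /nnsin -mulN1r -RintegralZl//; last exact: integrable_trans.
  by apply: eq_Rintegral => x _; ring.
by move=> y z; rewrite mulrDr cosD; ring.
Qed.

Lemma nnsin_conv s u v : nnint u -> nnint v ->
  nnsin s (u ** v) = nnsin s u * nncos s v + nncos s u * nnsin s v.
Proof.
move=> iu iv; have bc := bounded1_cos s; have bs := bounded1_sin s.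
rewrite [LHS](@nntrans_conv _ _ _ _ _ _ u v iu iv bs bs bc bc bs)//.
by move=> y z; rewrite mulrDr sinD; ring.
Qed.

Lemma nncos_add s u v : nnint u -> nnint v ->
  nncos s (nnadd u v) = nncos s u + nncos s v.
Proof. by move=> iu iv; exact: nntrans_add iu iv (bounded1_cos s). Qed.

Lemma nnsin_add s u v : nnint u -> nnint v ->
  nnsin s (nnadd u v) = nnsin s u + nnsin s v.
Proof. by move=> iu iv; exact: nntrans_add iu iv (bounded1_sin s). Qed.

Lemma nncos_shift s h u : nnint u ->
  nncos s (nnshift h u) = cos (s * h) * nncos s u - sin (s * h) * nnsin s u.
Proof.
move=> iu; have ic := integrable_trans iu (bounded1_cos s);
  have is_ := integrable_trans iu (bounded1_sin s).
rewrite [LHS](nntrans_shift h iu (bounded1_cos s)) /nntrans /nncos /nnsin.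
transitivity (\int[mu]_x (cos (s * h) * (fine (u x) * cos (s * x)) - sin (s * h) *
  (fine (u x) * sin (s * x)))).
  by apply: eq_Rintegral => x _; rewrite mulrDr cosD; ring.
rewrite RintegralB//; [|exact: (integrableZl measurableT _ ic)|
  exact: (integrableZl measurableT _ is_)].
by rewrite !RintegralZl.
Qed.

Lemma nnsin_shift s h u : nnint u ->
  nnsin s (nnshift h u) = sin (s * h) * nncos s u + cos (s * h) * nnsin s u.
Proof.
move=> iu; have ic := integrable_trans iu (bounded1_cos s);
  have is_ := integrable_trans iu (bounded1_sin s).
rewrite [LHS](nntrans_shift h iu (bounded1_sin s)) /nntrans /nncos /nnsin.
transitivity (\int[mu]_x (sin (s * h) * (fine (u x) * cos (s * x)) + cos (s * h) *
  (fine (u x) * sin (s * x)))).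
  by apply: eq_Rintegral => x _; rewrite mulrDr sinD; ring.
rewrite RintegralD//; [|exact: (integrableZl measurableT _ ic)|
  exact: (integrableZl measurableT _ is_)].
by rewrite !RintegralZl.
Qed.

Lemma nntrans_continuous u (trig : R -> R) : nnint u -> continuous trig ->
  (forall x, `|trig x| <= 1) -> continuous (fun s : R => \int[mu]_x (fine (u x) * trig
    (s * x))).
Proof.
move=> iu ct t1 s.
have mt (z : R) : measurable_fun setT (fun x : R => trig (z * x)).
  apply: continuous_measurable_fun => x.
  apply: (@continuous_comp R R R (fun x : R => z * x) trig); last exact: ct.
  by apply: cvgM; [exact: cvg_cst|exact: cvg_id].
have := @continuity_under_integral R _ _ mu (fun z x : R => fine (u x) * trig (z * x))
  setT measurableT (s - 1) (s + 1).
move=> /(_ _ _ (fun x => fine (u x)) (integrable_fine_nnf iu)) H.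
have : {in `](s - 1), (s + 1)[%classic, continuous (fun l : R => \int[mu]_x (fine (u x)
  * trig (l * x)))}.
  apply: H.
  - by move=> z _; exact: integrable_bounded_mul (integrable_fine_nnf iu) (mt z) (fun x
    => t1 _).
  - apply: aeW => x _ z _; apply: cvgM; first exact: cvg_cst.
    apply: (@continuous_comp R R R (fun z : R => z * x) trig); last exact: ct.
    by apply: cvgM; [exact: cvg_id|exact: cvg_cst].
  - move=> z _; apply: aeW => x _.
    have f0 : 0 <= fine (u x) by rewrite fine_ge0 ?nnf_ge0.
    by rewrite normrM ger0_norm// ler_piMr.
by apply; rewrite inE/= in_itv/=; apply/andP; split; lra.
Qed.

Lemma nntrans_le (phi : R -> R) u : nnint u -> bounded1 phi ->
  `|nntrans phi u| <= nntrans (fun=> 1) u.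
Proof.
move=> iu bp; apply: le_trans (le_normr_Rintegral measurableT (integrable_trans iu bp)) _.
apply: le_Rintegral => //.
- exact: (integrable_norm (integrable_trans iu bp)).
- exact: integrable_trans iu bounded1_cst.
move=> x _; have f0 : 0 <= fine (u x) by rewrite fine_ge0 ?nnf_ge0.
by rewrite normrM ger0_norm// mulr1 ler_piMr// bp.2.
Qed.

End trig_transforms.

(** * The equation (H + K) * g = H *)

Section renewal_of_transform.
Context {R : realType} (alpha : R).
Hypotheses (alpha_gt0 : 0 < alpha) (alpha_lt1 : alpha < 1).
Local Notation mu := (@lebesgue_measure R).
Local Notation k := (nnk alpha_gt0).
Variable g : nnfun R.
Hypotheses (g0 : supp 0 g) (ig : nnint g).
Hypothesis g_trans : forall s,
  nncos s g * (1 + s * nnsin s k) + nnsin s g * (s * nncos s k) = 1 /\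
  nnsin s g * (1 + s * nnsin s k) - nncos s g * (s * nncos s k) = 0.

Let ik := nnint_nnk alpha_gt0 alpha_lt1.

(** With B the transform of the box, e^{ish} - 1 = is B, so the transforms of the two sides differ
    by B (g^ (1 - is K^) - 1), which is 0. The two [transitivity] steps are the real and imaginary
    parts of this product. *)
Lemma renewal_box h (h0 : 0 < h) :
  {ae mu, forall x, (nnadd k (nnbox h) ** g) x =
    nnadd (nnshift h k ** g) (nnbox h) x}.
Proof.
have ib := nnint_nnbox h0; have is_ := nnint_shift h ik.
have isg := nnint_conv is_ ig.
have ikb := nnint_add ik ib.
apply: nnfun_fourier_inj.
- rewrite -(addr0 0); apply: supp_conv => //.
  by apply: supp_add; [exact: supp_nnk|exact: supp_nnbox].
- apply: supp_add; last exact: supp_nnbox.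
  rewrite -(addr0 0); apply: supp_conv => //.
  apply: supp_le (ltW h0) _.
  by have := @supp_shift _ 0 h _ (@supp_nnk _ _ alpha_gt0); rewrite add0r.
- exact: nnint_conv.
- exact: nnint_add.
- move=> s; rewrite nncos_conv// !nncos_add// nnsin_add// nncos_conv// nncos_shift//
  nnsin_shift//.
  rewrite -nncos_nnbox//; have -> : cos (s * h) = 1 - s * nnsin s (nnbox h) by rewrite
    nnsin_nnbox//; ring.
  have [e1 e2] := g_trans s; apply/eqP; rewrite -subr_eq0; apply/eqP.
  move: e1 e2; move: (nncos s g) (nnsin s g) (nncos s k) (nnsin s k) (nncos s (nnbox
    h)) (nnsin s (nnbox h)) => p q C S c d e1 e2.
  transitivity (c * (p * (1 + s * S) + q * (s * C) - 1) - d * (q * (1 + s * S) - p * (s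
    * C))); first ring.
  by rewrite e1 e2; ring.
- move=> s; rewrite nnsin_conv// !nnsin_add// nncos_add// nnsin_conv// nncos_shift//
  nnsin_shift//.
  rewrite -nncos_nnbox//; have -> : cos (s * h) = 1 - s * nnsin s (nnbox h) by rewrite
    nnsin_nnbox//; ring.
  have [e1 e2] := g_trans s; apply/eqP; rewrite -subr_eq0; apply/eqP.
  move: e1 e2; move: (nncos s g) (nnsin s g) (nncos s k) (nnsin s k) (nncos s (nnbox
    h)) (nnsin s (nnbox h)) => p q C S c d e1 e2.
  transitivity (d * (p * (1 + s * S) + q * (s * C) - 1) + c * (q * (1 + s * S) - p * (s
    * C))); first ring.
  by rewrite e1 e2; ring.
Qed.

(** No limit is taken: for x < h the translated term is 0 and the box can be replaced by H, so h = n
    + 1 settles all x < n + 1. *)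
Lemma renewal_equation : {ae mu, forall x, (nnadd nnstep k ** g) x = nnstep x}.
Proof.
have H (n : nat) : {ae mu, forall x, x < n.+1%:R -> (nnadd nnstep k ** g) x = nnstep x}.
  have h0 : 0 < n.+1%:R :> R by rewrite ltr0n.
  apply: ae_imp (renewal_box h0) => x + xn.
  rewrite nnconvDl nnconvDl -[X in X = _ -> _]/((k ** g) x + (nnbox n.+1%:R ** g) x)%E.
  rewrite -[X in _ = X -> _]/((nnshift n.+1%:R k ** g) x + nnbox n.+1%:R x)%E.
  have -> : (nnshift n.+1%:R k ** g) x = 0%E.
    have s1 : supp n.+1%:R (nnshift n.+1%:R k).
      by have := @supp_shift _ 0 n.+1%:R _ (@supp_nnk _ _ alpha_gt0); rewrite add0r.
    by apply: (supp_conv s1 g0); rewrite addr0 ltW.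
  have -> : (nnbox n.+1%:R ** g) x = (nnstep ** g) x.
    rewrite !(nnconvC _ g) !nnconvE; apply: eq_integral => y _.
    have [y0|y0] := leP y 0; first by rewrite g0// !mul0e.
    congr (_ * _)%E; rewrite /= /box.
    by have -> : (x - y < n.+1%:R); [rewrite ltrBlDr (lt_le_trans xn)// lerDl
      ltW|rewrite andbT].
  have -> : nnbox n.+1%:R x = nnstep x by rewrite /= /box xn andbT.
  by rewrite add0e addeC => <-.
have := (@ae_foralln _ _ _ mu _ H).
by apply: ae_imp => x; apply; exact: truncnS_gt.
Qed.

End renewal_of_transform.

(** * The density *)

Section density.
Context {R : realType}.
Local Notation leb := (@lebesgue_measure R).
Variables (mu : probability (measurableTypeR R) R) (g : R -> R).
Hypothesis hg : is_density mu g.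

Let mg : measurable_fun setT g. Proof. by case: hg. Qed.
Let g_ge0 x : 0 <= g x. Proof. by case: hg. Qed.
Let muE (A : set R) : measurable A -> mu A = (\int[leb]_(x in A) (g x)%:E)%E.
Proof. by case: hg => _ _; exact. Qed.

Let mu1 : mu setT = 1%E. Proof. exact: probability_setT. Qed.

(** [is_density] only gives measures of sets; integrals of h are reached by identifying g almost
    everywhere with the Radon-Nikodym derivative. *)
Lemma Rintegral_density (h : R -> R) : bounded1 h ->
  \int[mu]_x h x = \int[leb]_x (g x * h x).
Proof.
move=> [mh h1].
have dom : mu `<< leb.
  apply/null_content_dominatesP => A mA A0.
  rewrite muE//; apply: null_set_integral => //.
  by apply/measurable_EFinP; exact: measurable_funTS mg.
have ih : mu.-integrable setT (EFin \o h).
  apply: (@measurable_bounded_integrable _ _ _ mu h setT) => //.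
  - by move: (@ltry R 1); rewrite -mu1.
  - exists 1; split => // M M1 x _ /=; exact: le_trans (h1 x) (ltW M1).
rewrite /Rintegral; congr fine.
rewrite -(Radon_Nikodym_change_of_variables dom measurableT ih).
apply: ae_eq_integral => //.
- by apply: emeasurable_funM; [exact/measurable_EFinP|
  exact: measurable_int (Radon_Nikodym_integrable _)].
- by apply/measurable_EFinP; exact: measurable_funM.
have : ae_eq leb setT (Radon_Nikodym (charge_of_finite_measure mu) leb) (EFin \o g).
  apply: integral_ae_eq => //.
  - exact: Radon_Nikodym_integrable.
  - exact/measurable_EFinP.
  - by move=> E _ mE; rewrite -Radon_Nikodym_integral// -[LHS]/(mu E) muE.
by apply: ae_imp => x /(_ I) /= ->; rewrite -EFinM mulrC.
Qed.

Hypothesis mu_pos : mu `[0, +oo[%classic = 1%E.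

(** A density may be nonzero on a null part of ]-oo, 0[, or at 0; the cut makes the support
    condition hold at every point. *)
Definition half (x : R) : R := if 0 < x then g x else 0.

Lemma measurable_half : measurable_fun setT half.
Proof. by apply: measurable_fun_ifT => //; exact: measurable_fun_ltr. Qed.

Lemma half_ge0 x : 0 <= half x. Proof. by rewrite /half; case: ifP. Qed.

Definition nnhalf := nnreal measurable_half half_ge0.

Lemma supp_nnhalf : supp 0 nnhalf.
Proof. by move=> x x0; rewrite /= /half ltNge x0. Qed.

Lemma half_ae : {ae leb, forall x, half x = g x}.
Proof.
have m0 : measurable (`]-oo, 0%R[%classic : set R) by exact: measurable_itv.
have i0 : (\int[leb]_(x in `]-oo, 0%R[) `|(g x)%:E| = 0)%E.
  under eq_integral do rewrite gee0_abs ?lee_fin//.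
  rewrite -muE// (_ : `]-oo, 0%R[%classic = ~` `[0, +oo[%classic); last first.
    by rewrite setCitvr.
  by rewrite probability_setC// mu_pos subee.
have mgE : measurable_fun (`]-oo, 0%R[%classic : set R) (EFin \o g).
  by apply/measurable_EFinP; exact: measurable_funTS mg.
have := (ae_eq_integral_abs leb m0 mgE).1 i0.
move=> h; apply: ae_imp (ae_and h (ae_neq 0)) => x [hx x0].
rewrite /half; case: (ltgtP 0 x) x0 => // x0 _.
by have := hx x0 => -[].
Qed.

Lemma nnint_nnhalf : nnint nnhalf.
Proof.
rewrite /nnint; have -> : (\int[leb]_x nnhalf x)%E = mu setT.
  rewrite muE//; apply: ge0_ae_eq_integral => //.
  - exact: nnf_measurable.
  - exact/measurable_EFinP.
  - by move=> x _; exact: nnf_ge0.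
  - by move=> x _; rewrite lee_fin.
  by apply: ae_imp half_ae => x hx _; rewrite /= hx.
by rewrite mu1 ltry.
Qed.

Lemma Rintegral_nnhalf (h : R -> R) : bounded1 h ->
  \int[mu]_x h x = nntrans h nnhalf.
Proof.
move=> bh; rewrite (Rintegral_density bh) /nntrans /Rintegral; congr fine.
apply: ae_eq_integral => //.
- by apply/measurable_EFinP; apply: measurable_funM => //; exact: bh.1.
- apply/measurable_EFinP; apply: measurable_funM; [exact: measurable_half|exact: bh.1].
by apply: ae_imp half_ae => x hx _; rewrite /= hx.
Qed.

Lemma nntrans_nnhalf_le1 (h : R -> R) : bounded1 h -> `|nntrans h nnhalf| <= 1.
Proof.
move=> bh; apply: le_trans (nntrans_le nnint_nnhalf bh) _.
rewrite -(Rintegral_nnhalf bounded1_cst) Rintegral_cst// mul1r.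
have e : fine (mu setT) <= 1 by rewrite mu1.
exact: e.
Qed.

Variable alpha : R.
Hypotheses (alpha_gt0 : 0 < alpha) (alpha_lt1 : alpha < 1).
Hypothesis mu_char : forall s, char_fun mu s = dm_char_fun alpha s.
Local Notation k := (nnk alpha_gt0).

Let ik := nnint_nnk alpha_gt0 alpha_lt1.

(** The denominator 1 - is K^(s) is [a s] - i [b s]. *)
Let a s := 1 + s * nnsin s k.
Let b s := s * nncos s k.

Lemma char_inverse s : (nncos s nnhalf +i* nnsin s nnhalf)%C = (a s -i* b s)^-1%C.
Proof.
have := mu_char s; rewrite /char_fun /dm_char_fun (limn_dm_series alpha_gt0 alpha_lt1).
rewrite (Rintegral_nnhalf (bounded1_cos s)) (Rintegral_nnhalf (bounded1_sin s)).
move=> ->; congr (_^-1); apply/eqP; rewrite eq_complex/= /a /b.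
by rewrite !mul0r !sub0r !add0r opprK !eqxx.
Qed.

Let N s := a s ^+ 2 + b s ^+ 2.

Lemma continuous_charden_norm : continuous N.
Proof.
have cc : continuous (fun s : R => nncos s k).
  exact: (nntrans_continuous ik (@continuous_cos R) (@cos_max R)).
have cs : continuous (fun s : R => nnsin s k).
  exact: (nntrans_continuous ik (@continuous_sin R) (@sin_max R)).
move=> s; apply: cvgD; apply: cvgM; rewrite /a /b.
- by apply: cvgD; [exact: cvg_cst|apply: cvgM; [exact: cvg_id|exact: cs]].
- by apply: cvgD; [exact: cvg_cst|apply: cvgM; [exact: cvg_id|exact: cs]].
- by apply: cvgM; [exact: cvg_id|exact: cc].
- by apply: cvgM; [exact: cvg_id|exact: cc].
Qed.

Lemma charden_mul s : N s != 0 ->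
  nncos s nnhalf * a s + nnsin s nnhalf * b s = 1 /\
  nnsin s nnhalf * a s - nncos s nnhalf * b s = 0.
Proof.
move=> N0; have D0 : (a s -i* b s)%C != 0.
  apply: contraNN N0; rewrite eq_complex/= => /andP[/eqP a0 /eqP b0].
  by rewrite /N a0 -[b s ^+ 2]sqrrN b0 !expr0n addr0.
have : (nncos s nnhalf +i* nnsin s nnhalf)%C * (a s -i* b s)%C = 1.
  by rewrite char_inverse mulVf.
move/eqP; rewrite eq_complex/= => /andP[/eqP h1 /eqP h2]; split.
  by rewrite -h1; ring.
by rewrite -h2; ring.
Qed.

(** Where the denominator is nonzero, |phi|^2 N = 1, and the real and imaginary parts of phi are
    each at most 1 in absolute value, so |phi|^2 <= 2. *)
Lemma charden_norm_lb s : N s != 0 -> 2^-1 <= N s.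
Proof.
move=> N0; have [h1 h2] := charden_mul N0.
have p1 := nntrans_nnhalf_le1 (bounded1_cos s);
  have q1 := nntrans_nnhalf_le1 (bounded1_sin s).
set p := nncos s nnhalf in h1 h2; set q := nnsin s nnhalf in h1 h2.
have e : (p ^+ 2 + q ^+ 2) * N s = 1.
  transitivity ((p * a s + q * b s) ^+ 2 + (q * a s - p * b s) ^+ 2);
    first by rewrite /N; ring.
  by rewrite h1 h2; ring.
have sq (z : R) : `|z| <= 1 -> z ^+ 2 <= 1.
  by move=> z1; rewrite -real_normK ?num_real// expr_le1.
have pq : p ^+ 2 + q ^+ 2 <= 2.
  rewrite -[X in _ <= X]/(1 + 1) lerD//.
    exact: sq p1.
  exact: sq q1.
have Np : 0 <= N s by rewrite addr_ge0 ?sqr_ge0.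
have := ler_wpM2r Np pq; rewrite e; move: (N s) => n; lra.
Qed.

(* At a zero of the denominator [char_inverse] only reads [0 = 0^-1]; zeros are
   excluded because [N] is continuous, takes values in {0} or [1/2, +oo[, and
   equals 1 at 0. *)
Lemma charden_norm_neq0 s : N s != 0.
Proof.
have N0 : N 0 = 1 by rewrite /N /a /b !mul0r addr0 expr1n expr0n addr0.
apply/negP => /eqP Ns.
(* The value 1/4 lies in the gap between 0 and 1/2, which the intermediate value theorem would make
   N cross. *)
have sub (x y : R) : x <= y -> Num.min (N x) (N y) <= 4^-1 <= Num.max (N x) (N y) ->
  False.
  move=> xy h; have cN : {within `[x, y], continuous N}.
    by apply: continuous_subspaceT; exact: continuous_charden_norm.
  have [c _ Nc] := IVT xy cN h.
  have : N c != 0 by rewrite Nc invr_neq0// pnatr_eq0.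
  move/charden_norm_lb; rewrite Nc; lra.
have [s0|s0] := leP 0 s.
  apply: (sub 0 s s0); rewrite N0 Ns ge_min le_max; apply/andP; split; apply/orP;
    [right|left]; lra.
apply: (sub s 0 (ltW s0)); rewrite N0 Ns ge_min le_max; apply/andP; split; apply/orP;
  [left|right]; lra.
Qed.

Lemma dm_density_representative : {ae leb, forall x, dm_density alpha x = g x}.
Proof.
have r := renewal_equation alpha_lt1 supp_nnhalf nnint_nnhalf (fun s => charden_mul
  (charden_norm_neq0 s)).
have := dm_density_ae alpha_lt1 supp_nnhalf (fun x => ltry _) r.
by move=> h; apply: ae_imp (ae_and h half_ae) => x [-> <-].
Qed.

End density.

(* A density is only defined up to a null set: [h] is the representative of
   the density [g] which is continuous outside the integers. *)
Theorem theorem4 (R : realType) (alpha : R)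
    (alpha_gt0 : 0 < alpha) (alpha_lt1 : alpha < 1) :
  (forall k : nat, (1 <= k)%N -> forall j : nat, (j < k)%N ->
     forall x : R, x \isn't a Num.int ->
       opE_annihilates_at alpha k (dm_g alpha j) x) /\
  (forall (mu : probability (measurableTypeR R) R) (g : R -> R),
     is_dm_distribution alpha mu -> is_density mu g ->
     exists h : R -> R,
       [/\ {ae @lebesgue_measure R, forall x, h x = g x},
           (forall x : R, x \isn't a Num.int -> {for x, continuous h}) &
           forall k : nat, (1 <= k)%N ->
             forall x : R, 0 <= x <= k%:R -> x \isn't a Num.int ->
               opE_annihilates_at alpha k h x]).
Proof.
split; first by move=> k _ j jk x nx; exact: dm_g_annihilated.
move=> mu g [mu_pos mu_char] hg; exists (dm_density alpha); split.
- exact: (dm_density_representative hg mu_pos alpha_gt0 alpha_lt1 mu_char).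
- by move=> x nx; exact: dm_density_continuous.
- by move=> k _ x /andP[_ xk] nx; exact: dm_density_annihilated.
Qed.
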